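(* Let $\mathbb F_2$ be the free group on two generators, acting freely by homeomorphisms on a compact Hausdorff space $X$, and suppose that there is an $\mathbb F_2$-invariant regular Borel probability measure $\mu$ on $X$. Then there are uncountably many distinct $C^*$-norms $\eta$ on $C_c(\mathbb F_2,C(X))$ satisfying $\|x\|_r\le\eta(x)\le\|x\|_f$ for all $x\in C_c(\mathbb F_2,C(X))$.
   Context: An action of a discrete group $\Gamma$ on $X$ is free if $sx\neq x$ for every $x\in X$ and every $e\neq s\in\Gamma$. With $\tau_s(a)(x)=a(s^{-1}x)$ for $a\in C(X)$, $C_c(\Gamma,C(X))$ is the $*$-algebra of finitely supported functions $\Gamma\to C(X)$ with $(ab)(t)=\sum_{s}a(s)\tau_s(b(s^{-1}t))$ and $a^*(t)=\tau_t(a(t^{-1}))^*$. $\|\cdot\|_r$ and $\|\cdot\|_f$ denote the reduced and full crossed product $C^*$-norms on $C_c(\Gamma,C(X))$. *)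

(* Defs.v *)
From HB Require Import structures.
From mathcomp Require Import all_boot all_order all_algebra.
From mathcomp Require Import complex.
From mathcomp Require Import all_classical all_reals all_analysis.

Set Implicit Arguments.
Unset Strict Implicit.
Unset Printing Implicit Defensive.

Import Order.TTheory GRing.Theory Num.Theory.
Import numFieldNormedType.Exports.

Local Open Scope classical_set_scope.
Local Open Scope ring_scope.
Local Open Scope complex_scope.

Section FreeGroup.
Variable T : choiceType.

(* (x, false) stands for the generator x and (x, true) for its inverse *)
Definition letter := (T * bool)%type.
Definition linv (l : letter) : letter := (l.1, ~~ l.2).
Arguments linv : simpl never.

Definition reduced (w : seq letter) : bool := sorted (fun l m => m != linv l) w.

Definition lcons (l : letter) (w : seq letter) : seq letter :=
  if w is m :: w' then if m == linv l then w' else l :: w else [:: l].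

Lemma linvK : involutive linv.
Proof. by case=> x b; rewrite /linv /= negbK. Qed.

Lemma reduced_lcons l w : reduced w -> reduced (lcons l w).
Proof.
case: w => [//|m w] /=; case: ifPn => [_ /path_sorted//|ne pw].
by rewrite /= ne.
Qed.

Lemma lconsK l w : reduced w -> lcons (linv l) (lcons l w) = w.
Proof.
case: w => [|m w] /=; first by rewrite linvK eqxx.
case: eqP => [-> |_ _]; last by rewrite /= linvK eqxx.
case: w => [//|k w] /= /andP[].
by rewrite linvK => /negbTE ->.
Qed.

Lemma reduced_foldr w v : reduced v -> reduced (foldr lcons v w).
Proof. by move=> rv; elim: w => //= l w IH; exact: reduced_lcons. Qed.

(* An element of the free group on T is a reduced word; the product of x and y
   prepends the letters of x to y one by one, cancelling where possible. *)
Record free_group := FreeGroup {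
  fword :> seq letter;
  fword_reduced : reduced fword }.

HB.instance Definition _ := [isSub for fword].
HB.instance Definition _ := [Choice of free_group by <:].

Lemma foldr_lcons l w v : reduced w -> reduced v ->
  foldr lcons v (lcons l w) = lcons l (foldr lcons v w).
Proof.
case: w => [//|m w] /= rw rv; case: eqP => [-> |//].
by rewrite -{1}(linvK l) lconsK // reduced_foldr.
Qed.

Lemma foldr_foldr (x y z : seq letter) : reduced y -> reduced z ->
  foldr lcons z (foldr lcons y x) = foldr lcons (foldr lcons z y) x.
Proof.
move=> ry rz; elim: x => //= l x IH.
by rewrite foldr_lcons ?IH // reduced_foldr.
Qed.

Lemma reduced_inv w : reduced w -> reduced (rev (map linv w)).
Proof.
rewrite /reduced rev_sorted sorted_map; apply: sub_sorted => l m /=.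
by rewrite linvK eq_sym.
Qed.

Lemma foldr_id w : reduced w -> foldr lcons [::] w = w.
Proof.
elim: w => //= l w IH pw; rewrite IH; last exact: path_sorted pw.
by case: w pw {IH} => //= m w /andP[/negbTE ->].
Qed.

Definition fg_one := @FreeGroup [::] isT.
Definition fg_mul (x y : free_group) :=
  FreeGroup (reduced_foldr x (fword_reduced y)).
Definition fg_inv (x : free_group) := FreeGroup (reduced_inv (fword_reduced x)).

Lemma fg_mulA : associative fg_mul.
Proof.
move=> x y z; apply: val_inj => /=.
by rewrite foldr_foldr //; exact: fword_reduced.
Qed.

Lemma fg_mul1g : left_id fg_one fg_mul.
Proof. by move=> x; exact: val_inj. Qed.

Lemma fg_mulg1 : right_id fg_one fg_mul.
Proof. by move=> x; apply: val_inj; exact: foldr_id (fword_reduced x). Qed.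

Lemma fg_mulVg : left_inverse fg_one fg_inv fg_mul.
Proof.
case=> w rw; apply: val_inj => /=; elim: w rw => //= l w IH pw.
rewrite rev_cons foldr_rcons -[X in _ = X](IH (path_sorted pw)).
congr foldr; case: w pw {IH} => [_|m w /= /andP[nm pw]].
  by rewrite /= linvK eqxx.
by rewrite /= linvK eqxx.
Qed.

Lemma fg_mulgV : right_inverse fg_one fg_inv fg_mul.
Proof.
move=> x; have -> : x = fg_inv (fg_inv x).
  apply: val_inj => /=; rewrite map_rev revK -map_comp.
  by rewrite (eq_map (g := id)) ?map_id // => l; exact: linvK.
have -> : fg_inv (fg_inv (fg_inv x)) = fg_inv x.
  apply: val_inj => /=; rewrite map_rev revK -map_comp.
  by rewrite (eq_map (g := id)) ?map_id // => l; exact: linvK.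
exact: fg_mulVg.
Qed.

HB.instance Definition _ :=
  isGroup.Build free_group fg_mulA fg_mul1g fg_mulg1 fg_mulVg fg_mulgV.

End FreeGroup.

Definition F2 : groupType := free_group bool.

(* each [act s] is a homeomorphism, with continuous inverse [act s^-1] *)
Record haction (G : groupType) (X : topologicalType) := HAction {
  act :> G -> X -> X;
  act1 : forall x, act 1%g x = x;
  actM : forall s t x, act (s * t)%g x = act s (act t x);
  act_continuous : forall s, continuous (act s) }.

Definition free_action (G : groupType) (X : topologicalType)
    (al : haction G X) : Prop :=
  forall x s, s != 1%g -> al s x <> x.

Notation borel X := (g_sigma_algebraType (@open X)).

Definition regular_measure (R : realType) (X : ptopologicalType)
    (mu : {measure set (borel X) -> \bar R}) : Prop :=
  forall A : set (borel X), measurable A ->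
    mu A = ereal_inf [set mu U | U in [set U : set X | open U /\ A `<=` U]] /\
    mu A = ereal_sup [set mu K | K in [set K : set X | compact K /\ K `<=` A]].

Definition invariant_measure (R : realType) (G : groupType)
    (X : ptopologicalType) (al : haction G X)
    (mu : {measure set (borel X) -> \bar R}) : Prop :=
  forall (s : G) (A : set (borel X)), measurable A -> mu (al s @^-1` A) = mu A.

Section CX.
Variables (R : realType) (X : topologicalType).

Definition cts_pred : {pred X -> R[i]^o} := mem [set f | continuous f].

Record CX := MkCX {
  cx_fun :> X -> R[i]^o;
  cx_cts : cx_fun \in cts_pred }.

HB.instance Definition _ := [isSub for cx_fun].
HB.instance Definition _ := [Choice of CX by <:].

Lemma CX_continuous (a : CX) : continuous a.
Proof. exact: set_mem (cx_cts a). Qed.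

Lemma cts_subring : subring_closed cts_pred.
Proof.
split.
- apply: mem_set => x; exact: cvg_cst.
- move=> f g /set_mem cf /set_mem cg.
  apply: mem_set => x; exact: cvgB (cf x) (cg x).
- move=> f g /set_mem cf /set_mem cg.
  apply: mem_set => x; exact: cvgM (cf x) (cg x).
Qed.
HB.instance Definition _ := GRing.isSubringClosed.Build _ cts_pred cts_subring.
HB.instance Definition _ :=
  GRing.SubChoice_isSubComPzRing.Build _ _ CX (subringClosedP cts_pred).

Lemma cts_submod : submod_closed cts_pred.
Proof.
split; first by apply: mem_set => x; exact: cvg_cst.
move=> c f g /set_mem cf /set_mem cg; apply: mem_set => x.
apply: (cvgD _ (cg x)).
have cc : cst (c : R[i]^o) z @[z --> x] --> (c : R[i]^o) by exact: cvg_cst.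
exact: cvgM cc (cf x).
Qed.
HB.instance Definition _ := GRing.isSubmodClosed.Build _ _ cts_pred cts_submod.
HB.instance Definition _ := [SubZmodule_isSubLmodule of CX by <:].

Lemma conj_cts (a : CX) : (fun x => (a x)^* ) \in cts_pred.
Proof.
rewrite inE => x; apply/cvgrPdist_lt => e e0.
have /cvgrPdist_lt/(_ _ e0) := @CX_continuous a x.
by apply: filterS => y; rewrite -rmorphB normcJ.
Qed.

Definition CX_star (a : CX) : CX := MkCX (conj_cts a).

End CX.

Section CrossedProductAlgebra.
Variables (R : realType) (G : groupType) (X : topologicalType).

Definition fin_supp : {pred G -> CX R X} :=
  mem [set f | finite_set [set s | f s != 0]].

Record Cc := MkCc {
  cc_fun :> G -> CX R X;
  cc_fin : cc_fun \in fin_supp }.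

HB.instance Definition _ := [isSub for cc_fun].
HB.instance Definition _ := [Choice of Cc by <:].

Lemma Cc_finite (a : Cc) : finite_set [set s | a s != 0].
Proof. exact: set_mem (cc_fin a). Qed.

Lemma fin_supp_submod : submod_closed fin_supp.
Proof.
split=> [|c f g]; rewrite !inE /=.
  by apply: (sub_finite_set _ (finite_set0 _)) => s /=; rewrite eqxx.
move=> ff fg; apply:
  (@sub_finite_set _ _ ([set s | f s != 0] `|` [set s | g s != 0])).
  move=> s /=; case: (eqVneq (f s) 0) => [fs0|]; last by left.
  by rewrite /= !fctE fs0 scaler0 add0r; right.
by rewrite finite_setU.
Qed.
HB.instance Definition _ := GRing.isSubmodClosed.Build _ _ fin_supp fin_supp_submod.
HB.instance Definition _ := [SubChoice_isSubLmodule of Cc by <:].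

Variable al : haction G X.

Lemma tau_cts (s : G) (a : CX R X) : (fun x => a (al s^-1%g x)) \in
  @cts_pred R X.
Proof.
rewrite inE => x; apply: continuous_comp; first exact: act_continuous.
exact: CX_continuous.
Qed.

Definition tau (s : G) (a : CX R X) : CX R X := MkCX (tau_cts s a).

Lemma tau0 s : tau s 0 = 0. Proof. exact: val_inj. Qed.

Lemma conv_fin (a b : Cc) :
  (fun t => \sum_(s \in [set: G]) a s * tau s (b (s^-1 * t)%g)) \in fin_supp.
Proof.
rewrite inE /=.
apply: (@sub_finite_set _ _ ((fun p => (p.1 * p.2)%g) @`
  ([set s | a s != 0] `*` [set s | b s != 0]))); last first.
  by apply: finite_image; apply: finite_setX; exact: Cc_finite.
move=> t /=; apply: contra_neqP => nt; apply: fsbig1 => s _.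
have [->|as0] := eqVneq (a s) 0; first by rewrite mul0r.
have [->|bs0] := eqVneq (b (s^-1 * t)%g) 0; first by rewrite tau0 mulr0.
by case: nt; exists (s, (s^-1 * t)%g) => //=; rewrite mulgA mulgV mul1g.
Qed.

Definition Cc_mul (a b : Cc) : Cc := MkCc (conv_fin a b).

Lemma star_fin (a : Cc) : (fun t => CX_star (tau t (a t^-1%g))) \in fin_supp.
Proof.
rewrite inE /=; apply: (@sub_finite_set _ _ ((fun s => s^-1%g) @` [set s | a s != 0])).
  move=> t /=; have [->|ne _] := eqVneq (a t^-1%g) 0.
    rewrite tau0 => /negP[]; apply/eqP/val_inj/funext => x /=.
    exact: conjc0.
  by exists t^-1%g => //=; rewrite invgK.
by apply: finite_image; exact: Cc_finite.
Qed.

Definition Cc_star (a : Cc) : Cc := MkCc (star_fin a).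

End CrossedProductAlgebra.

Section Hilbert.
Variable R : realType.

Definition form_norm (V : lmodType R[i]) (f : {dot V for Num.conj}) (v : V) :
  R := Num.sqrt (complex.Re (f v v)).

(* the inner product is linear in its first argument *)
Record hilbert := Hilbert {
  hsort :> lmodType R[i];
  hdot : {dot hsort for Num.conj};
  hcomplete : forall u : nat -> hsort,
    (forall e : R, 0 < e -> exists N, forall m n, (N <= m)%N -> (N <= n)%N ->
       form_norm hdot (u m - u n) < e) ->
    exists l : hsort, form_norm hdot (u n - l) @[n --> \oo] --> (0 : R) }.

Definition hnorm (H : hilbert) (v : H) : R := form_norm (hdot H) v.

(* the norms defined as suprema take values in \bar R, so that the definitions
   do not presuppose their finiteness *)
Definition opnorm (H : hilbert) (T : H -> H) : \bar R :=
  ereal_sup [set (hnorm (T v))%:E | v in [set v : H | hnorm v <= 1]].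

Section StarAlgebra.
Variables (A : lmodType R[i]) (mul : A -> A -> A) (star : A -> A).

(* a *-homomorphism from (A, mul, star) to B(H); it may be degenerate *)
Record star_rep (H : hilbert) := StarRep {
  rep :> A -> {linear H -> H};
  rep_bounded : forall a, exists M : R, forall v, hnorm (rep a v) <= M * hnorm v;
  rep_linear : forall v, linear (fun a => rep a v);
  rep_mul : forall a b v, rep (mul a b) v = rep a (rep b v);
  rep_star : forall a u v, hdot H (rep a u) v = hdot H u (rep (star a) v) }.

Definition faithful (H : hilbert) (rho : star_rep H) : Prop :=
  forall a b : A, (forall v, rho a v = rho b v) -> a = b.

Record cstar_norm (eta : A -> R) : Prop := CstarNorm {
  cstar_ge0 : forall a, 0 <= eta a;
  cstar_eq0 : forall a, eta a = 0 -> a = 0;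
  cstarD : forall a b, eta (a + b) <= eta a + eta b;
  cstarZ : forall (c : R[i]) a, (eta (c *: a))%:C = `|c| * (eta a)%:C;
  cstarM : forall a b, eta (mul a b) <= eta a * eta b;
  cstarE : forall a, eta (mul (star a) a) = eta a ^+ 2 }.

End StarAlgebra.
End Hilbert.

Section CrossedProductNorms.
Variables (R : realType) (G : groupType) (X : topologicalType).
Variable al : haction G X.

Definition CX_rep (H : hilbert R) :=
  star_rep (fun a b : CX R X => a * b) (@CX_star R X) H.

Definition Cc_rep (H : hilbert R) :=
  star_rep (@Cc_mul R G X al) (@Cc_star R G X al) H.

Definition full_norm (a : Cc R G X) : \bar R :=
  ereal_sup [set r | exists (H : hilbert R) (rho : Cc_rep H), r = opnorm (rho a)].

Section Reduced.
Variables (H : hilbert R) (rho : CX_rep H).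

(* the squared norm of xi in l^2(G, H), and +oo if xi is not in it *)
Definition l2norm_sq (xi : G -> H) : \bar R :=
  \esum_(t in [set: G]) ((hnorm (xi t)) ^+ 2)%:E.

(* The regular representation of C_c(G, C(X)) on l^2(G, H) integrating
   (f xi)(t) = rho (tau_{t^-1} f) (xi t)  and  (s xi)(t) = xi (s^-1 t). *)
Definition regular_rep (a : Cc R G X) (xi : G -> H) (t : G) : H :=
  \sum_(s \in [set: G]) rho (tau al t^-1%g (a s)) (xi (s^-1 * t)%g).

Definition reduced_norm (a : Cc R G X) : \bar R :=
  ereal_sup [set sqrte (l2norm_sq (regular_rep a xi)) |
              xi in [set xi : G -> H | (l2norm_sq xi <= 1)%E]].

End Reduced.
End CrossedProductNorms.

(* Main.v *)
(* For 0 < r < 1 the function g |-> r^|g| is positive definite on F_2: writing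
   d for the distance in the Cayley tree, r^d(s,t) is the sum over the common
   prefixes v of s and t of c_v r^(|s|-|v|) r^(|t|-|v|), with c_e = 1 and
   c_v = 1 - r^2 otherwise. Together with the invariant measure it gives the
   state a |-> \sum_g r^|g| \int a(g) dmu on C_c(F_2, C(X)), hence a
   representation pi_r, and eta_r := max(|.|_r, |pi_r(.)|) is a C*-norm between
   the reduced and the full one.

   These norms are told apart by the sum x of the generators and their inverses: for
   2/3 < r < 1, eta_r(x) = 3r + 1/r, which is injective in r.
   Upper bound, for both representations: all coefficients <u_g v, v> are
   O(r^|g|) and r^|.| is superharmonic for the eigenvalue 3r + 1/r, so
   <x^k v, v> = O((3r + 1/r)^k), and x is self-adjoint. Lower bound: r^|g|
   dominates an eigenfunction of the adjacency operator which is positive at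
   the identity, so <x^k v, v> >= c (3r + 1/r)^k for the cyclic vector v. *)

Require Import Defs.
From HB Require Import structures.
From mathcomp Require Import all_boot all_order all_algebra.
From mathcomp Require Import complex.
From mathcomp Require Import all_classical all_reals all_analysis.
From mathcomp Require Import measurable_realfun.
From mathcomp Require Import ring lra.

Set Implicit Arguments.
Unset Strict Implicit.
Unset Printing Implicit Defensive.

Import Order.TTheory GRing.Theory Num.Theory.
Import numFieldNormedType.Exports.

Local Open Scope classical_set_scope.
Local Open Scope ring_scope.

(** * Semi-inner products *)

(** Representations live on spaces with a possibly degenerate semi-inner product, and [pnorm] is
    computed there, so null vectors are never divided out. A Hilbert space completion is built only
    to compare [pnorm] with the full norm, a supremum over Hilbert spaces. The maximum with the
    regular representation does two things: it dominates the reduced norm, and it provides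
    definiteness, since mu may vanish on a nonempty open set and pi_r then kills functions supported
    there. The coefficient bounds carry a constant that depends on v. Self-adjointness of x makes
    the norms of x^k v log-convex in k, so only the growth rate matters and the constant disappears.
    The number 2/3 is a rational above 1/sqrt 3: r and 1/(3r) give the same eigenvalue 3r + 1/r, and
    1/sqrt 3 is the fixed point of this exchange. Representations of C(X) may be degenerate, so 1
    may act as a proper projection; the coefficients studied are those of U_g L(1). *)

Section ComplexModulus.
Variable R : realType.
Implicit Types (z w : R[i]) (r : R).
Local Open Scope complex_scope.

Definition cmod z : R := Normc.normc z.

Lemma normc_cmod z : `|z| = (cmod z)%:C.
Proof. by case: z. Qed.

Lemma cmod_ge0 z : 0 <= cmod z.
Proof. by rewrite -lecR -normc_cmod normr_ge0. Qed.

Lemma cmodD z w : cmod (z + w) <= cmod z + cmod w.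
Proof. exact: (@le_normcD R z w). Qed.

Lemma cmodM z w : cmod (z * w) = cmod z * cmod w.
Proof. exact: Normc.normcM. Qed.

Lemma cmodN z : cmod (- z) = cmod z.
Proof. exact: (@normcN R z). Qed.

Lemma cmodB z w : cmod (z - w) <= cmod z + cmod w.
Proof. by rewrite -(cmodN w) cmodD. Qed.

Lemma cmod0 : cmod 0 = 0.
Proof. exact: Normc.normc0. Qed.

Lemma cmod_eq0 z : cmod z = 0 -> z = 0.
Proof. exact: Normc.eq0_normc. Qed.

Lemma cmodJ z : cmod (conjc z) = cmod z.
Proof. by case: z => a b; rewrite /cmod /= sqrrN. Qed.

Lemma cmodr r : cmod r%:C = `|r|.
Proof. by rewrite /cmod /= expr0n /= addr0 sqrtr_sqr. Qed.

Lemma Re_cmod z : `|complex.Re z| <= cmod z.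
Proof.
by rewrite -lecR -normc_cmod normc_ge_Re.
Qed.

Lemma Im_cmod z : `|complex.Im z| <= cmod z.
Proof.
case: z => a b /=; rewrite /cmod /= -[`|b|]sqrtr_sqr ler_wsqrtr //.
by rewrite lerDr sqr_ge0.
Qed.

Lemma cmod_le_ReIm z : cmod z <= `|complex.Re z| + `|complex.Im z|.
Proof.
case: z => a b /=; rewrite /cmod /= -[X in _ <= X]ger0_norm ?addr_ge0 //.
rewrite -sqrtr_sqr ler_wsqrtr // sqrrD !real_normK ?num_real //.
by rewrite lerD2r lerDl mulrn_wge0 // mulr_ge0.
Qed.

Lemma mulJc z : z * conjc z = (cmod z ^+ 2)%:C.
Proof. by rewrite -sqr_normc normc_cmod rmorphXn. Qed.

Lemma ge0cE z : 0 <= z -> z = (complex.Re z)%:C.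
Proof. by move=> z0; rewrite RRe_real // realE z0. Qed.

Lemma ge0_Re z : 0 <= z -> 0 <= complex.Re z.
Proof. by move=> z0; rewrite -ler0c -ge0cE. Qed.

Lemma ReD z w : complex.Re (z + w) = complex.Re z + complex.Re w.
Proof. by case: z w => a b [c d]. Qed.

Lemma ReN z : complex.Re (- z) = - complex.Re z.
Proof. by case: z. Qed.

Lemma ImD z w : complex.Im (z + w) = complex.Im z + complex.Im w.
Proof. by case: z w => a b [c d]. Qed.

Lemma ImN z : complex.Im (- z) = - complex.Im z.
Proof. by case: z. Qed.

Lemma Re_rM r z : complex.Re (r%:C * z) = r * complex.Re z.
Proof. by case: z => a b /=; rewrite mul0r subr0. Qed.

Lemma ReJ z : complex.Re (conjc z) = complex.Re z.
Proof. by case: z. Qed.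

Lemma conjcM z w : conjc (z * w) = conjc z * conjc w.
Proof. exact: (rmorphM (@conjc R)). Qed.

Lemma conjc_sum (J : Type) (s : seq J) (F : J -> R[i]) :
  conjc (\sum_(i <- s) F i) = \sum_(i <- s) conjc (F i).
Proof. exact: (rmorph_sum (@conjc R)). Qed.

Lemma cmod_sum (I : Type) (s : seq I) (P : pred I) (F : I -> R[i]) :
  cmod (\sum_(i <- s | P i) F i) <= \sum_(i <- s | P i) cmod (F i).
Proof.
elim/big_ind2: _ => [|x1 x2 y1 y2 le1 le2|//]; first by rewrite cmod0.
by rewrite (le_trans (cmodD _ _)) // lerD.
Qed.

(** Asking only for e <= 1 lets callers absorb terms quadratic in the error into a linear bound. *)
Lemma le_mul_eps r M : (forall e, 0 < e -> e <= 1 -> r <= M * e) -> r <= 0.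
Proof.
move=> h; rewrite leNgt; apply/negP => r0.
have := h 1 ltr01 (lexx _); rewrite mulr1 => rM.
have M0 : 0 < M by lra.
have := h (r / (2 * M)); rewrite divr_gt0 ?mulr_gt0 // ler_pdivrMr ?mulr_gt0 //.
have -> : M * (r / (2 * M)) = r / 2 by field; lra.
by move=> /(_ isT); rewrite mul1r; lra.
Qed.

Lemma quadratic_discr (a b c : R) : 0 <= a -> 0 <= c ->
  (forall t, 0 <= a - 2 * t * b + t ^+ 2 * c) -> b ^+ 2 <= a * c.
Proof.
move=> a0 c0 h; have [c1|] := ltrP 0 c; last first.
  move=> c2; have -> : c = 0 by lra.
  have [->|b0] := eqVneq b 0; first by rewrite expr0n /= mulr0.
  (* With c = 0 the polynomial is affine in t, and this t gives it the value -1. *)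
  have := h ((a + 1) / (2 * b)); have -> : c = 0 by lra.
  have -> : 2 * ((a + 1) / (2 * b)) * b = a + 1 by field; lra.
  by lra.
have := h (b / c).
have -> : a - 2 * (b / c) * b + (b / c) ^+ 2 * c = (a * c - b ^+ 2) / c.
  by field; lra.
by rewrite pmulr_lge0 ?invr_gt0 // subr_ge0.
Qed.

End ComplexModulus.

Section SemiInnerProduct.
Variable R : realType.
Local Open Scope complex_scope.

Record semi_inner (V : lmodType R[i]) := SemiInner {
  ip :> V -> V -> R[i];
  ip_linear : forall (w : V) a u v, ip (a *: u + v) w = a * ip u w + ip v w;
  ip_herm : forall u v, ip u v = conjc (ip v u);
  ip_ge0 : forall u, 0 <= ip u u }.

Variables (V : lmodType R[i]) (B : semi_inner V).

Definition snorm (u : V) : R := Num.sqrt (complex.Re (B u u)).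

Lemma ipDl u v w : B (u + v) w = B u w + B v w.
Proof. by have := ip_linear B w 1 u v; rewrite scale1r mul1r. Qed.

Lemma ip0l w : B 0 w = 0.
Proof.
have := ipDl 0 0 w; rewrite addr0 => /esym/eqP.
by rewrite -subr_eq0 addrK => /eqP.
Qed.

Lemma ipZl a u w : B (a *: u) w = a * B u w.
Proof. by have := ip_linear B w a u 0; rewrite addr0 ip0l addr0. Qed.

Lemma ipNl u w : B (- u) w = - B u w.
Proof. by rewrite -scaleN1r ipZl mulN1r. Qed.

Lemma ipBl u v w : B (u - v) w = B u w - B v w.
Proof. by rewrite ipDl ipNl. Qed.

Lemma ipDr u v w : B w (u + v) = B w u + B w v.
Proof. by rewrite !(ip_herm B w) ipDl rmorphD. Qed.

Lemma ip0r w : B w 0 = 0.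
Proof. by rewrite ip_herm ip0l conjc0. Qed.

Lemma ipZr a u w : B w (a *: u) = conjc a * B w u.
Proof. by rewrite !(ip_herm B w) ipZl rmorphM. Qed.

Lemma ipNr u w : B w (- u) = - B w u.
Proof. by rewrite !(ip_herm B w) ipNl rmorphN. Qed.

Lemma ipBr u v w : B w (u - v) = B w u - B w v.
Proof. by rewrite ipDr ipNr. Qed.

Lemma ip_suml (I : Type) (s : seq I) (F : I -> V) w :
  B (\sum_(i <- s) F i) w = \sum_(i <- s) B (F i) w.
Proof. by elim/big_ind2: _ => [|x1 x2 y1 y2 <- <-|//]; rewrite ?ip0l ?ipDl. Qed.

Lemma ip_sumr (I : Type) (s : seq I) (F : I -> V) w :
  B w (\sum_(i <- s) F i) = \sum_(i <- s) B w (F i).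
Proof. by elim/big_ind2: _ => [|x1 x2 y1 y2 <- <-|//]; rewrite ?ip0r ?ipDr. Qed.

Lemma snorm_ge0 u : 0 <= snorm u. Proof. exact: sqrtr_ge0. Qed.

Lemma sqr_snorm u : snorm u ^+ 2 = complex.Re (B u u).
Proof. by rewrite sqr_sqrtr // ge0_Re // ip_ge0. Qed.

Lemma Re_ip_CS u v : complex.Re (B u v) ^+ 2 <= snorm u ^+ 2 * snorm v ^+ 2.
Proof.
apply: quadratic_discr; rewrite ?sqr_ge0 // => t.
have := ge0_Re (ip_ge0 B (u - t%:C *: v)).
rewrite ipBl !ipBr !ipZl !ipZr !conjc_real !(ReD, ReN, Re_rM) -!sqr_snorm.
rewrite (ip_herm B v u) ReJ; lra.
Qed.

Lemma snormZ a u : snorm (a *: u) = cmod a * snorm u.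
Proof.
rewrite /snorm ipZl ipZr mulrA mulJc Re_rM sqrtrM ?sqr_ge0 //.
by rewrite sqrtr_sqr ger0_norm // cmod_ge0.
Qed.

Lemma ip_CS u v : cmod (B u v) <= snorm u * snorm v.
Proof.
have [z0|z0] := eqVneq (cmod (B u v)) 0; first by rewrite z0 mulr_ge0 ?snorm_ge0.
have zp : 0 < cmod (B u v) by rewrite lt0r z0 cmod_ge0.
(* Scaling v by [B u v] makes the inner product equal to the real number |B u v|^2. *)
have := Re_ip_CS u (B u v *: v).
rewrite ipZr mulrC mulJc /= snormZ => h.
rewrite -(@ler_pXn2r _ 2) ?nnegrE ?mulr_ge0 ?snorm_ge0 ?cmod_ge0 //.
rewrite -(@ler_pM2r _ (cmod (B u v) ^+ 2)) ?exprn_gt0 //.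
apply: (@le_trans _ _ (snorm u ^+ 2 * (cmod (B u v) * snorm v) ^+ 2)) => //.
by rewrite !exprMn; lra.
Qed.

Lemma snormD u v : snorm (u + v) <= snorm u + snorm v.
Proof.
rewrite -(@ler_pXn2r _ 2) ?nnegrE ?addr_ge0 ?snorm_ge0 //.
rewrite sqr_snorm ipDl !ipDr !ReD -!sqr_snorm (ip_herm B v u) ReJ.
have := le_trans (ler_norm _) (le_trans (Re_cmod (B u v)) (ip_CS u v)).
by rewrite sqrrD; lra.
Qed.

Lemma snorm0 : snorm 0 = 0.
Proof. by rewrite /snorm ip0l sqrtr0. Qed.


End SemiInnerProduct.

(** * C*-seminorms of pre-Hilbert representations *)

Section PreHilbertRepresentation.
Variable R : realType.
Variables (A : lmodType R[i]) (mul : A -> A -> A) (star : A -> A).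
Local Open Scope complex_scope.

(** The bound sends null vectors of B to null vectors, which is what replaces passing to a
    quotient. *)
Record pre_rep (V : lmodType R[i]) (B : semi_inner V) := PreRep {
  prep :> A -> V -> V;
  prep_linearl : forall v c a b, prep (c *: a + b) v = c *: prep a v + prep b v;
  prep_linearr : forall a c u v, prep a (c *: u + v) = c *: prep a u + prep a v;
  prep_bounded : forall a, exists M, forall v, snorm B (prep a v) <= M * snorm B v;
  prep_mul : forall a b v, prep (mul a b) v = prep a (prep b v);
  prep_star : forall a u v, B (prep a u) v = B u (prep (star a) v) }.

Variables (V : lmodType R[i]) (B : semi_inner V) (pi : pre_rep B).

Lemma prepZr a c v : pi a (c *: v) = c *: pi a v.
Proof.
have p0 : pi a 0 = 0.
  have := prep_linearr pi a 1 0 0; rewrite !scale1r addr0 => /eqP.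
  by rewrite addrC -subr_eq subrr => /eqP.
by have := prep_linearr pi a c v 0; rewrite !addr0 p0 addr0.
Qed.

Definition pnorm_set a : set R :=
  [set snorm B (pi a v) | v in [set v | snorm B v <= 1]].

Definition pnorm a : R := sup (pnorm_set a).

Lemma has_sup_pnorm a : has_sup (pnorm_set a).
Proof.
split; first by exists (snorm B (pi a 0)), 0 => //=; rewrite snorm0 ler01.
have [M hM] := prep_bounded pi a; exists `|M| => _ [v /= v1 <-].
rewrite (le_trans (hM v)) // (le_trans (ler_wpM2r (snorm_ge0 _ _) (ler_norm M))) //.
by rewrite ler_piMr.
Qed.

Lemma snorm_prep a v : snorm B (pi a v) <= pnorm a * snorm B v.
Proof.
have [v0|v0] := eqVneq (snorm B v) 0.
  (* A null vector cannot be normalised, but boundedness makes its image null too. *)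
  by have [M hM] := prep_bounded pi a; have := hM v; rewrite v0 !mulr0.
have vp : 0 < snorm B v by rewrite lt0r v0 snorm_ge0.
set c := (snorm B v)^-1; rewrite -ler_pdivrMr //.
have cv w : snorm B (c%:C *: w) = c * snorm B w.
  by rewrite snormZ cmodr ger0_norm // invr_ge0 ltW.
rewrite mulrC -cv -prepZr; apply: ub_le_sup; first by case: (has_sup_pnorm a).
by exists (c%:C *: v) => //=; rewrite cv mulVf.
Qed.

Lemma pnorm_le a M : 0 <= M ->
  (forall v, snorm B (pi a v) <= M * snorm B v) -> pnorm a <= M.
Proof.
move=> M0 hM; apply: ge_sup; first by case: (has_sup_pnorm a).
by move=> _ [v /= v1 <-]; rewrite (le_trans (hM v)) // ler_piMr.
Qed.

Lemma pnorm_ge0 a : 0 <= pnorm a.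
Proof.
apply: le_trans (snorm_ge0 B (pi a 0)) _; apply: ub_le_sup.
  by case: (has_sup_pnorm a).
by exists 0; rewrite //= snorm0 ler01.
Qed.

Lemma pnormD a b : pnorm (a + b) <= pnorm a + pnorm b.
Proof.
apply: pnorm_le => [|v]; first by rewrite addr_ge0 ?pnorm_ge0.
have := prep_linearl pi v 1 a b; rewrite !scale1r => ->.
by rewrite (le_trans (snormD _ _ _)) // mulrDl lerD ?snorm_prep.
Qed.

Lemma prepZl c a v : pi (c *: a) v = c *: pi a v.
Proof.
have p0 : pi 0 v = 0.
  have := prep_linearl pi v 1 0 0; rewrite !scale1r addr0 => /eqP.
  by rewrite addrC -subr_eq subrr => /eqP.
by have := prep_linearl pi v c a 0; rewrite !addr0 p0 addr0.
Qed.

Lemma pnormZ c a : pnorm (c *: a) = cmod c * pnorm a.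
Proof.
have h d b : pnorm (d *: b) <= cmod d * pnorm b.
  apply: pnorm_le => [|v]; first by rewrite mulr_ge0 ?pnorm_ge0 ?cmod_ge0.
  by rewrite prepZl snormZ -mulrA ler_wpM2l ?cmod_ge0 ?snorm_prep.
apply/le_anti; rewrite h /=.
have [->|c0] := eqVneq c 0; first by rewrite cmod0 mul0r pnorm_ge0.
have cp : 0 < cmod c.
  by rewrite lt0r cmod_ge0 andbT; apply: contra c0 => /eqP/cmod_eq0 ->.
rewrite mulrC -ler_pdivlMr // mulrC.
rewrite (le_trans _ (_ : cmod c^-1 * pnorm (c *: a) <= _)) //; last first.
  by rewrite [cmod _]Normc.normcV.
by rewrite -{1}(scale1r a) -(mulVf c0) -scalerA h.
Qed.

Lemma pnormM a b : pnorm (mul a b) <= pnorm a * pnorm b.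
Proof.
apply: pnorm_le => [|v]; first by rewrite mulr_ge0 ?pnorm_ge0.
rewrite prep_mul (le_trans (snorm_prep _ _)) // -mulrA.
by rewrite ler_wpM2l ?pnorm_ge0 ?snorm_prep.
Qed.

(** With w = a^* v, |w|^2 = Re <a w, v> <= |a| |w| |v|, and one factor |w| cancels. *)
Lemma pnorm_star a : pnorm (star a) <= pnorm a.
Proof.
apply: pnorm_le => [|v]; first exact: pnorm_ge0.
set w := pi (star a) v.
have [->|w0] := eqVneq (snorm B w) 0; first by rewrite mulr_ge0 ?pnorm_ge0 ?snorm_ge0.
have wp : 0 < snorm B w by rewrite lt0r w0 snorm_ge0.
have e : snorm B w * snorm B w = complex.Re (B (pi a w) v).
  by rewrite -expr2 (sqr_snorm B w) {2}/w -prep_star.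
rewrite -(ler_pM2r wp) e.
apply: le_trans (ler_norm _) (le_trans (Re_cmod _) (le_trans (ip_CS _ _ _) _)).
by rewrite mulrAC ler_wpM2r ?snorm_ge0 // snorm_prep.
Qed.

(** The nontrivial half is |a v|^2 = Re <v, a^* a v> <= |a^* a| |v|^2. *)
Lemma pnorm_cstar a : pnorm (mul (star a) a) = pnorm a ^+ 2.
Proof.
apply/le_anti/andP; split.
  by rewrite (le_trans (pnormM _ _)) // expr2 ler_wpM2r ?pnorm_ge0 ?pnorm_star.
have n0 := pnorm_ge0 (mul (star a) a).
rewrite -(sqr_sqrtr n0) ler_pXn2r ?nnegrE ?pnorm_ge0 ?sqrtr_ge0 //.
apply: pnorm_le => [|v]; first exact: sqrtr_ge0.
rewrite -(@ler_pXn2r _ 2) ?nnegrE ?mulr_ge0 ?sqrtr_ge0 ?snorm_ge0 //.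
rewrite exprMn (sqr_snorm B (pi a v)) sqr_sqrtr // prep_star -prep_mul.
apply: le_trans (ler_norm _) (le_trans (Re_cmod _) (le_trans (ip_CS _ _ _) _)).
by rewrite mulrC expr2 mulrA ler_wpM2r ?snorm_ge0 // snorm_prep.
Qed.

End PreHilbertRepresentation.

(** * Hilbert space completion *)

Section Completion.
Variable R : realType.
Local Open Scope complex_scope.

(** The intervals of centre f i and radius e i meet pairwise; the supremum of their left endpoints
    lies in all of them. This form of completeness keeps an explicit error for every index. *)
Lemma nested_real (I : Type) (P : I -> Prop) (f e : I -> R) :
  (exists i, P i) -> (forall i j, P i -> P j -> `|f i - f j| <= e i + e j) ->
  exists l, forall i, P i -> `|f i - l| <= e i.
Proof.
move=> [i0 Pi0] h; pose S := [set f i - e i | i in P].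
have ub j : P j -> ubound S (f j + e j).
  move=> Pj _ [i Pi <-]; have := le_trans (ler_norm _) (h i j Pi Pj); lra.
have hS : has_sup S by split; [exists (f i0 - e i0), i0|exists (f i0 + e i0); exact: ub].
exists (sup S) => i Pi; rewrite ler_norml.
have h1 : sup S <= f i + e i by apply: ge_sup (ub i Pi); case: hS.
have h2 : f i - e i <= sup S by apply: ub_le_sup; [case: hS|exists i].
by apply/andP; split; lra.
Qed.

(** The factor 2 comes from treating real and imaginary parts separately. *)
Lemma nested_complex (I : Type) (P : I -> Prop) (f : I -> R[i]) (e : I -> R) :
  (exists i, P i) -> (forall i j, P i -> P j -> cmod (f i - f j) <= e i + e j) ->
  exists l, forall i, P i -> cmod (f i - l) <= 2 * e i.
Proof.
move=> P0 h.
have [|a ha] := @nested_real I P (fun i => complex.Re (f i)) e P0.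
  move=> i j Pi Pj; rewrite -ReN -ReD.
  exact: le_trans (Re_cmod _) (h i j Pi Pj).
have [|b hb] := @nested_real I P (fun i => complex.Im (f i)) e P0.
  move=> i j Pi Pj; rewrite -ImN -ImD.
  exact: le_trans (Im_cmod _) (h i j Pi Pj).
exists (a +i* b) => i Pi; apply: le_trans (cmod_le_ReIm _) _.
rewrite ReD ReN ImD ImN /=; have := ha i Pi; have := hb i Pi; lra.
Qed.

Variables (V : lmodType R[i]) (B : semi_inner V).

(** The dual norm of F - B v is at most e. *)
Definition approx (F : V -> R[i]^o) (e : R) (v : V) : Prop :=
  forall w, cmod (F w - B v w) <= e * snorm B w.

Definition compl_pred : {pred V -> R[i]^o} := mem [set F : V -> R[i]^o |
  (forall c u v, F (c *: u + v) = conjc c * F u + F v) /\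
  (forall e, 0 < e -> exists v, approx F e v)].

(* The completion of V, realised inside its antidual as the norm closure of
   the functionals [B v]; no quotient is needed. *)
Record compl := MkCompl { compl_fun :> V -> R[i]^o; compl_in : compl_fun \in compl_pred }.

HB.instance Definition _ := [isSub for compl_fun].
HB.instance Definition _ := [Choice of compl by <:].

Lemma approxD c F G e d u v : approx F e u -> approx G d v ->
  approx (fun w => c * F w + G w) (cmod c * e + d) (c *: u + v).
Proof.
move=> hF hG w; rewrite ipDl ipZl.
have -> : c * F w + G w - (c * B u w + B v w) = c * (F w - B u w) + (G w - B v w) by ring.
apply: le_trans (cmodD _ _) _; rewrite cmodM mulrDl -mulrA lerD ?hG //.
by rewrite ler_wpM2l ?cmod_ge0 ?hF.
Qed.

Lemma compl_submod : submod_closed compl_pred.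
Proof.
split=> [|c F G]; rewrite !inE /=.
  split=> [*|e e0]; first by rewrite mulr0 addr0.
  by exists 0 => w; rewrite ip0l subr0 cmod0 mulr_ge0 ?snorm_ge0 // ltW.
move=> [lF aF] [lG aG]; split=> [d u v|e e0].
  rewrite /= !fctE lF lG /GRing.scale /=; ring.
have cp : 0 < cmod c + 1 by rewrite ltr_wpDl ?cmod_ge0.
have ep : 0 < e / (cmod c + 1) by rewrite divr_gt0.
have [u hu] := aF _ ep; have [v hv] := aG _ ep; exists (c *: u + v).
have -> : e = cmod c * (e / (cmod c + 1)) + e / (cmod c + 1) by field; lra.
exact: approxD.
Qed.
HB.instance Definition _ := GRing.isSubmodClosed.Build _ _ compl_pred compl_submod.
HB.instance Definition _ := [SubChoice_isSubLmodule of compl by <:].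

Implicit Types F G : compl.

Lemma complP F : (forall c u v, F (c *: u + v) = conjc c * F u + F v) /\
  (forall e, 0 < e -> exists v, approx F e v).
Proof. exact: set_mem (compl_in F). Qed.

Lemma compl_lin F c u v : F (c *: u + v) = conjc c * F u + F v.
Proof. by case: (complP F). Qed.

Lemma compl_approx F e : 0 < e -> exists v, approx F e v.
Proof. by case: (complP F) => _; apply. Qed.

Lemma complB F u v : F (u - v) = F u - F v.
Proof.
have e : conjc (-1 : R[i]) = -1 by rewrite rmorphN rmorph1.
by rewrite addrC -scaleN1r compl_lin e mulN1r addrC.
Qed.

Lemma snorm_le u M : 0 <= M -> (forall w, cmod (B u w) <= M * snorm B w) ->
  snorm B u <= M.
Proof.
move=> M0 h; have [->//|u0] := eqVneq (snorm B u) 0.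
have up : 0 < snorm B u by rewrite lt0r u0 snorm_ge0.
rewrite -(ler_pM2r up) -expr2 sqr_snorm.
exact: le_trans (ler_norm _) (le_trans (Re_cmod _) (h u)).
Qed.

Lemma compl_bounded F : exists2 C, 0 <= C & forall w, cmod (F w) <= C * snorm B w.
Proof.
have [v hv] := compl_approx F ltr01.
exists (1 + snorm B v) => [|w]; first by rewrite addr_ge0 ?snorm_ge0.
rewrite -(subrK (B v w) (F w)) (le_trans (cmodD _ _)) // mulrDl.
by rewrite lerD ?hv ?ip_CS.
Qed.

Lemma snorm_approxB F e d u v : 0 <= e -> 0 <= d -> approx F e u -> approx F d v ->
  snorm B (u - v) <= e + d.
Proof.
move=> e0 d0 hu hv; apply: snorm_le => [|w]; first exact: addr_ge0.
have -> : B (u - v) w = (F w - B v w) - (F w - B u w) by rewrite ipBl; ring.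
by rewrite (le_trans (cmodB _ _)) // mulrDl addrC lerD.
Qed.

(* <F, G> is the limit of F u as B u tends to G. *)
Definition compl_dot F G : R[i] := get [set z | exists C, forall e u,
  0 < e -> approx G e u -> cmod (z - F u) <= C * e].

Lemma compl_dotP F G : exists C, forall e u, 0 < e -> approx G e u ->
  cmod (compl_dot F G - F u) <= C * e.
Proof.
apply: (@getPex _ [set z | exists C, forall e u,
  0 < e -> approx G e u -> cmod (z - F u) <= C * e]).
have [C C0 hC] := compl_bounded F.
(* The indices are all pairs of a tolerance and an approximant of G, so the limit does not depend on
   a chosen sequence. *)
have [|p q [p0 hp] [q0 hq]|l hl] := @nested_complex (R * V)
  (fun p => 0 < p.1 /\ approx G p.1 p.2) (fun p => F p.2) (fun p => C * p.1).
- by have [v hv] := compl_approx G ltr01; exists (1, v).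
- rewrite -complB -mulrDr (le_trans (hC _)) // ler_wpM2l //.
  by apply: snorm_approxB hp hq; exact: ltW.
exists l; exists (2 * C) => e u e0 hu; rewrite -cmodN opprB -mulrA.
exact: (hl (e, u)).
Qed.

Lemma cmod_small (z : R[i]) C : (forall e, 0 < e -> e <= 1 -> cmod z <= C * e) -> z = 0.
Proof.
move=> h; apply: cmod_eq0; apply/le_anti; rewrite cmod_ge0 andbT.
exact: le_mul_eps h.
Qed.

Lemma compl_dot_uniq F G z C :
  (forall e, 0 < e -> e <= 1 -> exists2 u, approx G e u & cmod (z - F u) <= C * e) ->
  compl_dot F G = z.
Proof.
have [D hD] := compl_dotP F G => h.
apply/eqP; rewrite -subr_eq0; apply/eqP; apply: (@cmod_small _ (D + C)) => e e0 e1.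
have [u au hu] := h e e0 e1.
have -> : compl_dot F G - z = (compl_dot F G - F u) - (z - F u) by ring.
by rewrite (le_trans (cmodB _ _)) // mulrDl lerD // hD.
Qed.

Lemma compl_dot_lin G c F F' :
  compl_dot (c *: F + F') G = c * compl_dot F G + compl_dot F' G.
Proof.
have [C hC] := compl_dotP F G; have [C' hC'] := compl_dotP F' G.
apply: (@compl_dot_uniq _ _ _ (cmod c * C + C')) => e e0 _.
have [u hu] := compl_approx G e0; exists u => //.
have -> : c * compl_dot F G + compl_dot F' G - (c *: F + F') u =
  c * (compl_dot F G - F u) + (compl_dot F' G - F' u).
  by rewrite /= !fctE /GRing.scale /=; ring.
rewrite (le_trans (cmodD _ _)) // mulrDl lerD ?hC' // cmodM -mulrA.
by rewrite ler_wpM2l ?cmod_ge0 // hC.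
Qed.

Lemma snorm_approx_le F C e u : 0 <= C -> 0 <= e ->
  (forall w, cmod (F w) <= C * snorm B w) ->
  approx F e u -> snorm B u <= C + e.
Proof.
move=> C0 e0 hC hu; apply: snorm_le => [|w]; first exact: addr_ge0.
have -> : B u w = F w - (F w - B u w) by ring.
by rewrite (le_trans (cmodB _ _)) // mulrDl lerD.
Qed.

Lemma compl_dot_herm F G : compl_dot F G = conjc (compl_dot G F).
Proof.
have [D hD] := compl_dotP G F.
have [C C0 hC] := compl_bounded F; have [C' C'0 hC'] := compl_bounded G.
apply: (@compl_dot_uniq _ _ _ (D + (C + 1) + (C' + 1))) => e e0 e1.
have [u hu] := compl_approx G e0; have [v hv] := compl_approx F e0; exists u => //.
(* As u approximates G and v approximates F, both [G v] and [F u] are compared with the inner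
   product of u and v; e <= 1 keeps the norms of u and v bounded. *)
have -> : conjc (compl_dot G F) - F u =
  conjc (compl_dot G F - G v) + conjc (G v - B u v) - (F u - B v u).
  by rewrite !rmorphB /= -(ip_herm B v u); ring.
have l1 := hD e v e0 hv; have l2 := hu v; have l3 := hv u.
have s1 := snorm_approx_le C'0 (ltW e0) hC' hu.
have s2 := snorm_approx_le C0 (ltW e0) hC hv.
apply: le_trans (cmodB _ _) _; rewrite mulrDl lerD //.
  apply: le_trans (cmodD _ _) _; rewrite !cmodJ mulrDl lerD //.
  by apply: le_trans l2 _; rewrite mulrC ler_wpM2r ?(ltW e0) // (le_trans s2) // lerD2l.
by apply: le_trans l3 _; rewrite mulrC ler_wpM2r ?(ltW e0) // (le_trans s1) // lerD2l.
Qed.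

Lemma compl_dot_ge0 F : 0 <= compl_dot F F.
Proof.
have i0 : complex.Im (compl_dot F F) = 0.
  by have := compl_dot_herm F F; case: (compl_dot F F) => a b /= [] h; lra.
rewrite lecE i0 eqxx /= -oppr_le0.
have [D hD] := compl_dotP F F.
have [C C0 hC] := compl_bounded F.
apply: (@le_mul_eps R _ (D + (C + 1))) => e e0 e1.
have [u hu] := compl_approx F e0.
have s1 := snorm_approx_le C0 (ltW e0) hC hu.
have l1 := le_trans (Re_cmod _) (hD e u e0 hu).
have l2 := le_trans (Re_cmod _) (hu u).
have l3 : e * snorm B u <= (C + 1) * e.
  by rewrite mulrC ler_wpM2r ?(ltW e0) // (le_trans s1) // lerD2l.
have := ge0_Re (ip_ge0 B u).
rewrite !ReD !ReN !ler_norml in l1 l2.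
by move: l1 l2 => /andP[l1 _] /andP[l2 _]; lra.
Qed.

Definition compl_ip : semi_inner compl :=
  SemiInner (fun G c F F' => compl_dot_lin G c F F') compl_dot_herm compl_dot_ge0.

Lemma approx_emb v e : 0 <= e -> approx (B v) e v.
Proof. by move=> e0 w; rewrite subrr cmod0 mulr_ge0 ?snorm_ge0. Qed.

Lemma emb_in v : (B v : V -> R[i]^o) \in compl_pred.
Proof.
rewrite inE /=; split=> [c u w|e e0]; first by rewrite ipDr ipZr.
by exists v; apply: approx_emb; exact: ltW.
Qed.

Definition emb v : compl := MkCompl (emb_in v).

Lemma compl_dot_emb F v : compl_ip F (emb v) = F v.
Proof.
apply: (@compl_dot_uniq F (emb v) (F v) 0) => e e0 _; exists v.
  by apply: approx_emb; exact: ltW.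
by rewrite subrr cmod0 mul0r.
Qed.

Lemma snorm_emb v : snorm compl_ip (emb v) = snorm B v.
Proof. by rewrite /snorm compl_dot_emb. Qed.

Lemma compl_le F w : cmod (F w) <= snorm compl_ip F * snorm B w.
Proof. by rewrite -compl_dot_emb -snorm_emb ip_CS. Qed.

(** With [compl_le], this identifies the Hilbert norm of F with its norm as an antilinear
    functional. *)
Lemma snorm_compl_le F M : 0 <= M -> (forall w, cmod (F w) <= M * snorm B w) ->
  snorm compl_ip F <= M.
Proof.
move=> M0 hM; rewrite -(@ler_pXn2r _ 2) ?nnegrE ?snorm_ge0 // sqr_snorm -subr_le0.
have [D hD] := compl_dotP F F.
apply: (@le_mul_eps R _ (D + M)) => e e0 e1.
have [u hu] := compl_approx F e0.
have s1 := snorm_approx_le M0 (ltW e0) hM hu.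
have l1 := le_trans (Re_cmod _) (hD e u e0 hu).
have l2 := le_trans (ler_norm _) (le_trans (Re_cmod _) (hM u)).
have l3 := ler_wpM2l M0 s1.
rewrite !ReD !ReN !ler_norml in l1.
by move: l1 => /andP[_ l1]; rewrite /=; lra.
Qed.

Lemma snorm_emb_approx F e : 0 < e -> exists v, snorm compl_ip (F - emb v) <= e.
Proof.
move=> e0; have [v hv] := compl_approx F e0; exists v.
by apply: snorm_compl_le => [|w]; [exact: ltW|exact: hv].
Qed.

(** Definiteness comes from using functionals: one of norm zero vanishes at every w, although B
    itself may be degenerate. *)
Lemma compl_dot_gt0 F : F != 0 -> 0 < compl_dot F F.
Proof.
move=> F0; rewrite lt0r compl_dot_ge0 andbT; apply: contra F0 => /eqP F0.
have n0 : snorm compl_ip F = 0 by rewrite /snorm /= F0 sqrtr0.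
apply/eqP/val_inj/funext => w; apply: cmod_eq0; apply/le_anti.
by rewrite cmod_ge0 andbT (le_trans (compl_le F w)) // n0 mul0r.
Qed.

Lemma compl_dot_bilinear : bilinear_for *%R (Num.conj \; *%R) compl_dot.
Proof.
split=> [G c F F'|G c F F']; first exact: (ip_linear compl_ip).
by have := ipDr compl_ip (c *: F) F' G; rewrite (ipZr compl_ip).
Qed.
HB.instance Definition _ := bilinear_isBilinear.Build _ _ _ _ _ _ compl_dot
  compl_dot_bilinear.

Lemma compl_dot_hermitian F G :
  compl_dot F G = (-1) ^+ false * Num.conj (compl_dot G F).
Proof. by rewrite expr0 mul1r; exact: compl_dot_herm. Qed.
HB.instance Definition _ := isHermitianSesquilinear.Build _ _ _ _ compl_dot
  compl_dot_hermitian.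
HB.instance Definition _ := isDotProduct.Build _ _ compl_dot compl_dot_gt0.

(** The limit is taken pointwise on V; the error from [nested_complex] is proportional to the norm
    of w, which upgrades it to convergence in norm. *)
Lemma compl_complete (u : nat -> compl) :
  (forall e : R, 0 < e -> exists N, forall m n, (N <= m)%N -> (N <= n)%N ->
    form_norm compl_dot (u m - u n) < e) ->
  exists l : compl, form_norm compl_dot (u n - l) @[n --> \oo] --> (0 : R).
Proof.
move=> cu.
pose P (p : nat * R) := 0 < p.2 /\ forall m n, (p.1 <= m)%N -> (p.1 <= n)%N ->
  snorm compl_ip (u m - u n) < p.2.
have P0 : exists p, P p by have [N hN] := cu 1 ltr01; exists (N, 1).
have /choice[L hL] w : exists l, forall p, P p ->
    cmod (u p.1 w - l) <= 2 * (p.2 * snorm B w).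
  apply: nested_complex => // p q [p0 hp] [q0 hq].
  (* The Cauchy bound of each pair holds only within its own tail, so the comparison passes through
     an index in both tails. *)
  pose m := maxn p.1 q.1.
  have -> : u p.1 w - u q.1 w = (u p.1 - u m) w - (u q.1 - u m) w.
    by rewrite /= !fctE; ring.
  rewrite (le_trans (cmodB _ _)) // lerD // (le_trans (compl_le _ _)) //.
    by rewrite ler_wpM2r ?snorm_ge0 // ltW // hp ?leq_maxl.
  by rewrite ler_wpM2r ?snorm_ge0 // ltW // hq ?leq_maxr.
have hP e : 0 < e -> exists N, forall n, (N <= n)%N -> P (n, e).
  move=> e0; have [N hN] := cu e e0; exists N => n Nn; split=> //= k m hk hm.
  by apply: hN; [exact: leq_trans hk|exact: leq_trans hm].
have Lin : (L : V -> R[i]^o) \in compl_pred.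
  rewrite inE /=; split=> [c v w|e e0].
    apply/eqP; rewrite -subr_eq0; apply/eqP.
    apply: (@cmod_small _ (2 * snorm B (c *: v + w) + cmod c * (2 * snorm B v)
      + 2 * snorm B w)) => e e0 _.
    have [N /(_ N (leqnn _)) hN] := hP e e0.
    have -> : L (c *: v + w) - (conjc c * L v + L w) =
       conjc c * (u N v - L v) + (u N w - L w) - (u N (c *: v + w) - L (c *: v + w)).
      by rewrite compl_lin; ring.
    have h1 := hL (c *: v + w) _ hN; have h2 := hL v _ hN; have h3 := hL w _ hN.
    rewrite /= in h1 h2 h3.
    apply: le_trans (cmodB _ _) _.
    apply: le_trans (lerD (cmodD _ _) (lexx _)) _; rewrite cmodM cmodJ.
    have := ler_wpM2l (cmod_ge0 c) h2; lra.
  (* The factor 2 of [nested_complex] turns e / 4 into e / 2; the approximation of [u N] takes the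
     other half. *)
  have e4 : 0 < e / 4 by lra.
  have [N /(_ N (leqnn _)) hN] := hP _ e4.
  have e2 : 0 < e / 2 by lra.
  have [v hv] := compl_approx (u N) e2; exists v => w.
  have h1 := hL w _ hN; have h2 := hv w; rewrite /= in h1.
  have -> : L w - B v w = (u N w - B v w) - (u N w - L w) by ring.
  by apply: le_trans (cmodB _ _) _; lra.
exists (MkCompl Lin); apply/cvgrPdist_le => e e0.
have e2 : 0 < e / 2 by lra.
have [N hN] := hP _ e2.
near=> n; rewrite sub0r normrN ger0_norm; last exact: sqrtr_ge0.
apply: snorm_compl_le => [|w]; first exact: ltW.
have Nn : (N <= n)%N by near: n; exact: nbhs_infty_ge.
by have := hL w _ (hN n Nn); rewrite /= !fctE; lra.
Unshelve. all: by end_near.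
Qed.

Definition compl_hilbert : hilbert R := @Hilbert R compl compl_dot compl_complete.

End Completion.

(** * Extension of representations to the completion *)

Section ExtendRepresentation.
Variable R : realType.
Variables (A : lmodType R[i]) (mul : A -> A -> A) (star : A -> A).
Variables (V : lmodType R[i]) (B : semi_inner V) (pi : pre_rep mul star B).
Local Notation H := (compl B).
Implicit Types F G : H.

(** The difference v - w is a null vector, and F is bounded by the seminorm of B. *)
Lemma compl_ext F v w : (forall u, B u v = B u w) -> F v = F w.
Proof.
move=> h; apply/eqP; rewrite -subr_eq0 -complB; apply/eqP/cmod_eq0/le_anti.
rewrite cmod_ge0 andbT (le_trans (compl_le F _)) //.
have -> : snorm B (v - w) = 0 by rewrite /snorm ipBr h subrr sqrtr0.
by rewrite mulr0.
Qed.

(** The extension is defined by transposition: precomposing with [pi (star a)] turns [B v] into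
    [B (pi a v)], hence preserves approximability. *)
Lemma ext_in a F : ((fun w => F (pi (star a) w)) : V -> R[i]^o) \in compl_pred B.
Proof.
rewrite inE /=; split=> [c u v|e e0]; first by rewrite prep_linearr compl_lin.
have [M hM] := prep_bounded pi (star a).
have M0 : 0 < `|M| + 1 by rewrite ltr_wpDl.
have [v hv] := compl_approx F (divr_gt0 e0 M0); exists (pi a v) => w.
rewrite prep_star (le_trans (hv _)) // mulrAC ler_pdivrMr // -mulrA.
rewrite ler_wpM2l ?(ltW e0) // (le_trans (hM w)) // mulrC.
rewrite ler_wpM2l ?snorm_ge0 //; have := ler_norm M; lra.
Qed.

Definition ext a F : H := MkCompl (ext_in a F).

Lemma ext_linear a : linear (ext a).
Proof. by move=> c F G; apply: val_inj; apply/funext => w. Qed.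
HB.instance Definition _ a := GRing.isLinear.Build _ _ _ _ (ext a) (ext_linear a).

Lemma ext_bounded a : exists M, forall F,
  @hnorm R (compl_hilbert B) (ext a F) <= M * @hnorm R (compl_hilbert B) F.
Proof.
have [M hM] := prep_bounded pi (star a); exists `|M| => F.
apply: snorm_compl_le => [|w]; first by rewrite mulr_ge0 ?sqrtr_ge0.
apply: le_trans (compl_le F _) _; rewrite mulrAC mulrC ler_wpM2r ?sqrtr_ge0 //.
by rewrite (le_trans (hM w)) // ler_wpM2r ?snorm_ge0 ?ler_norm.
Qed.

Lemma ext_linearl F : linear (fun a => ext a F).
Proof.
move=> c a b; apply: val_inj; apply/funext => w /=; rewrite !fctE /=.
(* Antilinearity of [star] is not assumed; the adjoint relation gives it up to a null vector, which
   F does not see. *)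
have -> : F (pi (star (c *: a + b)) w) = F (conjc c *: pi (star a) w + pi (star b) w).
  apply: compl_ext => u.
  by rewrite -prep_star prep_linearl ipDl ipZl ipDr ipZr conjcK -!prep_star.
by rewrite compl_lin conjcK.
Qed.

Lemma ext_mul a b F : ext (mul a b) F = ext a (ext b F).
Proof.
apply: val_inj; apply/funext => w /=; apply: compl_ext => u.
by rewrite -!prep_star prep_mul.
Qed.

Lemma ext_emb a v : ext a (emb B v) = emb B (pi a v).
Proof. by apply: val_inj; apply/funext => w /=; rewrite prep_star. Qed.

(** For G in the image of V the identity is the definition of [ext]; density and boundedness give
    the rest. *)
Lemma ext_star a F G : compl_dot (ext a F) G = compl_dot F (ext (star a) G).
Proof.
apply/eqP; rewrite -subr_eq0; apply/eqP.
have [M hM] := ext_bounded (star a).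
apply: (@cmod_small _ _
  (snorm (compl_ip B) (ext a F) + snorm (compl_ip B) F * `|M|)) => e e0 _.
have [v hv] := snorm_emb_approx G e0.
have -> : compl_dot (ext a F) G - compl_dot F (ext (star a) G) =
   compl_ip B (ext a F) (G - emb B v) - compl_ip B F (ext (star a) (G - emb B v)).
  have -> : ext (star a) (G - emb B v) = ext (star a) G - ext (star a) (emb B v).
    exact: (raddfB (ext (star a))).
  by rewrite ext_emb !ipBr !compl_dot_emb /=; ring.
apply: le_trans (cmodB _ _) _; rewrite mulrDl lerD //.
  by apply: le_trans (ip_CS _ _ _) _; rewrite ler_wpM2l ?snorm_ge0.
apply: le_trans (ip_CS _ _ _) _; rewrite -mulrA ler_wpM2l ?snorm_ge0 //.
have h : M * snorm (compl_ip B) (G - emb B v) <= `|M| * e.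
  by rewrite (le_trans (ler_wpM2r (snorm_ge0 _ _) (ler_norm M))) // ler_wpM2l.
exact: le_trans (hM _) h.
Qed.

Definition ext_rep : star_rep mul star (compl_hilbert B) :=
  @StarRep R A mul star (compl_hilbert B) (fun a => ext a : {linear _ -> _})
    ext_bounded ext_linearl ext_mul ext_star.

Lemma pnorm_le_opnorm a : ((pnorm pi a)%:E <= opnorm (ext_rep a))%E.
Proof.
rewrite /pnorm -ereal_sup_EFin; [|by case: (has_sup_pnorm pi a)..].
apply: ge_ereal_sup => _ [_ [v /= v1 <-] <-]; apply: ereal_sup_ubound.
exists (emb B v) => /=.
  by have := snorm_emb B v; rewrite /snorm /hnorm /form_norm /= => ->.
by rewrite ext_emb; congr EFin; exact: (snorm_emb B).
Qed.

End ExtendRepresentation.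

(** * Covariant representations *)

Section FiniteSums.

Lemma fsum_seq (W : nmodType) (I : choiceType) (L : seq I) (f : I -> W) :
  uniq L -> (forall s, s \notin L -> f s = 0) ->
  \sum_(s \in [set: I]) f s = \sum_(s <- L) f s.
Proof.
move=> uL h; rewrite (@fsbigE _ _ _ _ _ L f) // => [|s _]; last exact: h.
by under eq_bigl do rewrite in_setT.
Qed.

Lemma finite_set_seq (I : choiceType) (A : set I) : finite_set A ->
  exists2 L : seq I, uniq L & forall s, s \notin L -> ~ A s.
Proof.
move=> fA; exists (finmap.enum_fset (fset_set A)); first exact: finmap.fset_uniq.
move=> s /negP h As; apply: h; have := in_fset_set fA s.
by rewrite mem_set.
Qed.

Lemma bij_mulg (G : groupType) (t : G) :
  set_bij [set: G] [set: G] (fun s => (t * s)%g).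
Proof.
split=> // [x y _ _|y _]; first exact: mulgI.
by exists (t^-1 * y)%g => //; rewrite mulgA mulgV mul1g.
Qed.

End FiniteSums.

Section CovariantRepresentation.
Variables (R : realType) (G : groupType) (X : topologicalType) (al : haction G X).
Local Open Scope complex_scope.
Local Notation A := (Cc R G X).

Record cov_rep (V : lmodType R[i]) (B : semi_inner V) := CovRep {
  covL : CX R X -> V -> V;
  covU : G -> V -> V;
  covL_linearl : forall c f g v, covL (c *: f + g) v = c *: covL f v + covL g v;
  covL_linearr : forall f c u v, covL f (c *: u + v) = c *: covL f u + covL f v;
  covLM : forall f g v, covL (f * g) v = covL f (covL g v);
  covL_star : forall f u v, B (covL f u) v = B u (covL (CX_star f) v);
  covL_bounded : forall f, exists2 M, 0 <= M &
    forall v, snorm B (covL f v) <= M * snorm B v;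
  covU_linear : forall s c u v, covU s (c *: u + v) = c *: covU s u + covU s v;
  covU1 : forall v, covU 1%g v = v;
  covUM : forall s t v, covU (s * t)%g v = covU s (covU t v);
  covU_star : forall s u v, B (covU s u) v = B u (covU s^-1%g v);
  covUL : forall s f v, covU s (covL f v) = covL (tau al s f) (covU s v) }.

Variables (V : lmodType R[i]) (B : semi_inner V) (pi : cov_rep B).
Local Notation L := (covL pi).
Local Notation U := (covU pi).

Lemma covLDl f g v : L (f + g) v = L f v + L g v.
Proof. by have := covL_linearl pi 1 f g v; rewrite !scale1r. Qed.

Lemma covL0l v : L 0 v = 0.
Proof.
have := covLDl 0 0 v; rewrite addr0 => /eqP.
by rewrite addrC -subr_eq subrr => /eqP.
Qed.

Lemma covLDr f u v : L f (u + v) = L f u + L f v.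
Proof. by have := covL_linearr pi f 1 u v; rewrite !scale1r. Qed.

Lemma covL0r f : L f 0 = 0.
Proof.
have := covLDr f 0 0; rewrite addr0 => /eqP.
by rewrite addrC -subr_eq subrr => /eqP.
Qed.

Lemma covUD s u v : U s (u + v) = U s u + U s v.
Proof. by have := covU_linear pi s 1 u v; rewrite !scale1r. Qed.

Lemma covU0 s : U s 0 = 0.
Proof.
have := covUD s 0 0; rewrite addr0 => /eqP.
by rewrite addrC -subr_eq subrr => /eqP.
Qed.

Lemma covL_suml (I : Type) (r : seq I) (F : I -> CX R X) v :
  L (\sum_(i <- r) F i) v = \sum_(i <- r) L (F i) v.
Proof. by elim/big_ind2: _ => [|x1 x2 y1 y2 <- <-|//]; rewrite ?covL0l ?covLDl. Qed.

Lemma covL_sumr (I : Type) (r : seq I) (F : I -> V) f :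
  L f (\sum_(i <- r) F i) = \sum_(i <- r) L f (F i).
Proof. by elim/big_ind2: _ => [|x1 x2 y1 y2 <- <-|//]; rewrite ?covL0r ?covLDr. Qed.

Lemma covU_sum (I : Type) (r : seq I) (F : I -> V) s :
  U s (\sum_(i <- r) F i) = \sum_(i <- r) U s (F i).
Proof. by elim/big_ind2: _ => [|x1 x2 y1 y2 <- <-|//]; rewrite ?covU0 ?covUD. Qed.

Lemma snorm_covU s v : snorm B (U s v) = snorm B v.
Proof. by rewrite /snorm covU_star -covUM mulVg covU1. Qed.

Definition integ (a : A) (v : V) : V := \sum_(s \in [set: G]) L (a s) (U s v).

Lemma Cc_supp (a : A) : exists2 r : seq G, uniq r & forall s, s \notin r -> a s = 0.
Proof.
have [r ur hr] := finite_set_seq (Cc_finite a); exists r => // s /hr h.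
by apply: contrapT => /eqP ?; apply: h.
Qed.

Lemma integ_seq (a : A) r v : uniq r -> (forall s, s \notin r -> a s = 0) ->
  integ a v = \sum_(s <- r) L (a s) (U s v).
Proof. by move=> ur hr; apply: fsum_seq => // s /hr ->; rewrite covL0l. Qed.

Lemma integ_linearl v c a b : integ (c *: a + b) v = c *: integ a v + integ b v.
Proof.
have [ra ura ha] := Cc_supp a; have [rb urb hb] := Cc_supp b.
pose r := undup (ra ++ rb).
have ur : uniq r by exact: undup_uniq.
have ha' s : s \notin r -> a s = 0 by rewrite mem_undup mem_cat => /norP[/ha].
have hb' s : s \notin r -> b s = 0 by rewrite mem_undup mem_cat => /norP[_ /hb].
rewrite !(integ_seq _ ur) //; last first.
  by move=> s sr; rewrite /= !fctE ha' ?hb' // scaler0 addr0.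
rewrite scaler_sumr -big_split /=; apply: eq_bigr => s _.
by rewrite -covL_linearl.
Qed.

Lemma integ_linearr (a : A) c u v : integ a (c *: u + v) = c *: integ a u + integ a v.
Proof.
have [r ur hr] := Cc_supp a; rewrite !(integ_seq _ ur hr) scaler_sumr -big_split /=.
by apply: eq_bigr => s _; rewrite covU_linear covL_linearr.
Qed.

Lemma integ_bounded a : exists M, forall v, snorm B (integ a v) <= M * snorm B v.
Proof.
have [r ur hr] := Cc_supp a.
suff [M _ hM] : exists2 M, 0 <= M & forall v,
    snorm B (\sum_(s <- r) L (a s) (U s v)) <= M * snorm B v.
  by exists M => v; rewrite (integ_seq _ ur hr).
elim: r {ur hr} => [|s r [M M0 IH]].
  by exists 0 => // v; rewrite big_nil snorm0 mul0r.
have [M' M'0 hM'] := covL_bounded pi (a s).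
exists (M' + M) => [|v]; first exact: addr_ge0.
rewrite big_cons (le_trans (snormD _ _ _)) // mulrDl lerD //.
by rewrite (le_trans (hM' _)) // snorm_covU.
Qed.

(** Covariance gives L(a s) U_s L(b t) U_t = L(a s * tau_s (b t)) U_(st); the substitution of s t
    for t then matches the convolution. The list [r] holds all products of elements of the two
    supports. *)
Lemma integ_mul a b v : integ (Cc_mul al a b) v = integ a (integ b v).
Proof.
have [ra ura ha] := Cc_supp a; have [rb urb hb] := Cc_supp b.
pose r := undup [seq (p.1 * p.2)%g | p <- [seq (x, y) | x <- ra, y <- rb]].
have ur : uniq r by exact: undup_uniq.
have hr s t : s \in ra -> t \notin r -> b (s^-1 * t)%g = 0.
  move=> sa tr; apply: hb; apply: contra tr => tb; rewrite mem_undup.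
  apply/mapP; exists (s, (s^-1 * t)%g); last by rewrite /= mulgA mulgV mul1g.
  by apply/allpairsP; exists (s, (s^-1 * t)%g).
have mulE t : Cc_mul al a b t = \sum_(s <- ra) a s * tau al s (b (s^-1 * t)%g).
  by apply: fsum_seq => // s /ha ->; rewrite mul0r.
rewrite (@integ_seq _ r) //; last first.
  move=> t tr; rewrite mulE big1_seq // => s /andP[_ sa].
  by rewrite (hr s t sa tr) tau0 mulr0.
rewrite (integ_seq (integ b v) ura ha).
under eq_bigr do rewrite mulE covL_suml.
rewrite exchange_big; apply: eq_big_seq => s sa /=.
rewrite -(@fsum_seq _ _ r) //; last first.
  by move=> t tr; rewrite (hr s t sa tr) tau0 mulr0 covL0l.
rewrite (reindex_fsbig _ _ _ _ (bij_mulg s)) /=.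
rewrite (integ_seq _ urb hb) covU_sum covL_sumr (@fsum_seq _ _ rb) //; last first.
  by move=> t /hb; rewrite mulgA mulVg mul1g => ->; rewrite tau0 mulr0 covL0l.
by apply: eq_bigr => t _; rewrite mulgA mulVg mul1g covUL covLM covUM.
Qed.

Lemma CX_star0 : CX_star (0 : CX R X) = 0.
Proof. by apply: val_inj; apply/funext => x /=; exact: conjc0. Qed.

Lemma integ_star a u v : B (integ a u) v = B u (integ (Cc_star al a) v).
Proof.
have [r ur hr] := Cc_supp a.
have -> : integ (Cc_star al a) v =
    \sum_(s \in [set: G]) U s^-1%g (L (CX_star (a s)) v).
  have bij : set_bij [set: G] [set: G] (fun u : G => u^-1%g).
    split=> // [x y _ _|y _]; first exact: invg_inj.
    by exists y^-1%g => //; rewrite invgK.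
  rewrite /integ (reindex_fsbig _ _ _ _ bij); apply: eq_fsbigr => s _ /=.
  rewrite covUL invgK; congr covL; exact: val_inj.
rewrite (integ_seq _ ur hr) (fsum_seq ur) => [|s /hr ->]; last first.
  by rewrite CX_star0 covL0l covU0.
rewrite ip_suml ip_sumr; apply: eq_bigr => s _.
by rewrite covL_star covU_star.
Qed.

Definition integ_rep : pre_rep (@Cc_mul R G X al) (@Cc_star R G X al) B :=
  PreRep integ_linearl integ_linearr integ_bounded integ_mul integ_star.

Lemma pnorm_le_full a : ((pnorm integ_rep a)%:E <= full_norm al a)%E.
Proof.
apply: le_trans (pnorm_le_opnorm integ_rep a) _.
by apply: ereal_sup_ubound; exists (compl_hilbert B), (ext_rep integ_rep).
Qed.

End CovariantRepresentation.

(** * Representations of C(X) *)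

Section ContinuousFunctions.
Variables (R : realType) (X : topologicalType).
Local Open Scope complex_scope.
Implicit Types f g : CX R X.

Lemma CX_lipschitz_continuous (phi : R[i] -> R) f :
  (forall z w, `|phi z - phi w| <= cmod (z - w)) -> continuous (phi \o f : X -> R).
Proof.
move=> hphi x; apply/cvgrPdist_lt => e e0.
have e0' : 0 < e%:C :> R[i] by rewrite ltcR.
have /cvgrPdist_lt/(_ _ e0') := @CX_continuous R X f x.
apply: filterS => y hy; apply: le_lt_trans (hphi _ _) _.
by rewrite -ltcR -normc_cmod.
Qed.

Lemma realC_cts (h : X -> R) : continuous h ->
  (fun x => (h x)%:C : R[i]^o) \in @cts_pred R X.
Proof.
move=> ch; rewrite inE => x; apply/cvgrPdist_lt => e e0.
(* The norm of [R[i]] takes values in [R[i]], so the tolerance is a positive complex number, hence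
   real. *)
have eE : e = (complex.Re e)%:C by apply: ge0cE; exact: ltW.
have e0' : 0 < complex.Re e by rewrite -ltcR -eE.
have /cvgrPdist_lt/(_ _ e0') := ch x.
apply: filterS => y hy.
have -> : `|(h x)%:C - (h y)%:C : R[i]^o| = `|h x - h y|%:C.
  have -> : (h x)%:C - (h y)%:C = (h x - h y)%:C :> R[i] by rewrite rmorphB.
  by rewrite -cmodr -normc_cmod.
by rewrite eE ltcR.
Qed.

Lemma cmod_lipschitz (z w : R[i]) : `|cmod z - cmod w| <= cmod (z - w).
Proof.
rewrite ler_norml; have := cmodD (z - w) w; rewrite subrK => h1.
have := cmodD (w - z) z; rewrite subrK -(cmodN (w - z)) opprB => h2.
by apply/andP; split; lra.
Qed.

Lemma CX_bounded f : compact [set: X] -> exists2 M, 0 <= M & forall x, cmod (f x) <= M.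
Proof.
move=> cX; pose h : X -> R := @cmod R \o f.
have ch : continuous h by apply: CX_lipschitz_continuous cmod_lipschitz.
have : compact (h @` [set: X]).
  by apply: continuous_compact => //; exact: continuous_subspaceT.
move=> /compact_bounded[N [_ hN]]; exists (`|N| + 1) => [|x].
  by rewrite addr_ge0.
have lN : N < `|N| + 1 by rewrite ltr_pwDr // ler_norm.
by have := hN _ lN (h x); rewrite /h /= ger0_norm ?cmod_ge0 //; apply; exists x.
Qed.

Lemma CXE_add f g x : (f + g) x = f x + g x. Proof. by []. Qed.
Lemma CXE_mul f g x : (f * g) x = f x * g x. Proof. by []. Qed.
Lemma CXE_scale c f x : (c *: f) x = c * f x. Proof. by []. Qed.

Lemma CX_eqP f g : (forall x, f x = g x) -> f = g.
Proof. by move=> h; apply: val_inj; apply/funext. Qed.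

End ContinuousFunctions.

(** * Representations of C(X) are contractive for the supremum norm *)

Section Contractive.
Variables (R : realType) (X : topologicalType) (H : hilbert R) (rho : CX_rep X H).
Local Open Scope complex_scope.

Lemma hdot_linear (w : H) c u v : hdot H (c *: u + v) w = c * hdot H u w + hdot H v w.
Proof. by rewrite linearDl /= linearZl_LR. Qed.

Lemma hdot_herm (u v : H) : hdot H u v = conjc (hdot H v u).
Proof. by rewrite hermC expr0 mul1r. Qed.

Lemma hdot_ge0 (u : H) : 0 <= hdot H u u.
Proof. exact: dnorm_ge0. Qed.

Definition hilbert_ip : semi_inner H := SemiInner hdot_linear hdot_herm hdot_ge0.

Lemma rep_linearl v c f g : rho (c *: f + g) v = c *: rho f v + rho g v.
Proof. exact: (rep_linear rho). Qed.

Lemma rep0l v : rho 0 v = 0.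
Proof.
have := rep_linearl v 1 0 0; rewrite !scale1r addr0 => /eqP.
by rewrite addrC -subr_eq subrr => /eqP.
Qed.

Lemma sqr_hnorm_rep f v :
  hnorm (rho f v) ^+ 2 = complex.Re (hdot H v (rho (CX_star f * f) v)).
Proof. by rewrite rep_mul -(rep_star rho) -(sqr_snorm hilbert_ip). Qed.

(** The operator [rho 1] is a self-adjoint idempotent: |rho 1 v|^2 = Re <v, rho 1 v>. *)
Lemma rep_unit_contractive v : hnorm (rho 1 v) <= hnorm v.
Proof.
have [->|n0] := eqVneq (hnorm (rho 1 v)) 0; first exact: sqrtr_ge0.
have np : 0 < hnorm (rho 1 v) by rewrite lt0r n0 sqrtr_ge0.
rewrite -(ler_pM2r np) -expr2 sqr_hnorm_rep.
have -> : CX_star 1 * 1 = 1 :> CX R X.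
  by rewrite mulr1; apply: CX_eqP => x; exact: conjc1.
exact: le_trans (ler_norm _) (le_trans (Re_cmod _) (ip_CS hilbert_ip _ _)).
Qed.

(* With g := sqrt (M^2 - |f|^2), |rho f v|^2 + |rho g v|^2 = M^2 |rho 1 v|^2. *)
Lemma rep_contractive (f : CX R X) M v : 0 <= M -> (forall x, cmod (f x) <= M) ->
  hnorm (rho f v) <= M * hnorm v.
Proof.
move=> M0 hM.
have ch : continuous (fun x => Num.sqrt (M ^+ 2 - cmod (f x) ^+ 2)).
  move=> x; apply: continuous_comp; last exact: sqrt_continuous.
  apply: cvgB; first exact: cvg_cst.
  by apply: cvgM; exact: (CX_lipschitz_continuous (f := f) (@cmod_lipschitz R)).
pose g : CX R X := MkCX (realC_cts ch).
have e : CX_star f * f + CX_star g * g = (M ^+ 2)%:C *: (CX_star 1 * 1).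
  apply: CX_eqP => x; rewrite CXE_add !CXE_mul CXE_scale CXE_mul.
  have -> : CX_star f x * f x = (cmod (f x) ^+ 2)%:C.
    by rewrite mulrC; exact: mulJc.
  have -> : CX_star g x * g x = (M ^+ 2 - cmod (f x) ^+ 2)%:C.
    rewrite mulrC; apply: etrans (mulJc _) _; congr (_%:C).
    rewrite cmodr real_normK ?num_real // sqr_sqrtr // subr_ge0.
    by rewrite ler_pXn2r ?nnegrE ?cmod_ge0.
  have -> : CX_star 1 x * (1 : CX R X) x = 1 :> R[i].
    by rewrite mulr1; exact: conjc1.
  by rewrite mulr1 -rmorphD addrC subrK.
have h : hnorm (rho f v) ^+ 2 + hnorm (rho g v) ^+ 2 = M ^+ 2 * hnorm (rho 1 v) ^+ 2.
  rewrite !sqr_hnorm_rep -ReD -(ipDr hilbert_ip).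
  have := rep_linearl v 1 (CX_star f * f) (CX_star g * g).
  rewrite !scale1r => <-; rewrite e.
  have := rep_linearl v (M ^+ 2)%:C (CX_star 1 * 1) 0.
  rewrite addr0 => ->; rewrite (ipDr hilbert_ip) (ipZr hilbert_ip) conjc_real.
  by rewrite rep0l (ip0r hilbert_ip) addr0 Re_rM.
rewrite -(@ler_pXn2r _ 2) ?nnegrE ?mulr_ge0 ?sqrtr_ge0 // exprMn.
apply: (@le_trans _ _ (M ^+ 2 * hnorm (rho 1 v) ^+ 2)).
  by rewrite -h lerDl sqr_ge0.
rewrite ler_wpM2l ?sqr_ge0 // ler_pXn2r ?nnegrE ?sqrtr_ge0 //.
exact: rep_unit_contractive.
Qed.

End Contractive.

(** * The regular representation *)

Section FinitelySupported.
Variables (R : realType) (G : groupType) (W : lmodType R[i]).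

Definition fs_pred : {pred G -> W} := mem [set f | finite_set [set s | f s != 0]].

(** With W = H this is the dense subspace of l^2(G, H) carrying the regular representation; with W =
    C(X) it carries the kernel form. *)
Record fs := MkFs { fs_fun :> G -> W; fs_in : fs_fun \in fs_pred }.

HB.instance Definition _ := [isSub for fs_fun].
HB.instance Definition _ := [Choice of fs by <:].

Lemma fs_submod : submod_closed fs_pred.
Proof.
split=> [|c f g]; rewrite !inE /=.
  by apply: (sub_finite_set _ (finite_set0 _)) => s /=; rewrite eqxx.
move=> ff fg; apply:
  (@sub_finite_set _ _ ([set s | f s != 0] `|` [set s | g s != 0])).
  move=> s /=; case: (eqVneq (f s) 0) => [fs0|]; last by left.
  by rewrite /= !fctE fs0 scaler0 add0r; right.
by rewrite finite_setU.
Qed.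
HB.instance Definition _ := GRing.isSubmodClosed.Build _ _ fs_pred fs_submod.
HB.instance Definition _ := [SubChoice_isSubLmodule of fs by <:].

Lemma fs_supp (f : fs) : exists2 r : seq G, uniq r & forall s, s \notin r -> f s = 0.
Proof.
have fin : finite_set [set s | f s != 0] by exact: set_mem (fs_in f).
have [r ur hr] := finite_set_seq fin; exists r => // s /hr h.
by apply: contrapT => /eqP ?; apply: h.
Qed.

Lemma fs_supp2 (f g : fs) : exists2 r : seq G, uniq r &
  forall s, s \notin r -> f s = 0 /\ g s = 0.
Proof.
have [r ur hr] := fs_supp f; have [q uq hq] := fs_supp g.
exists (undup (r ++ q)) => [|s]; first exact: undup_uniq.
by rewrite mem_undup mem_cat => /norP[/hr -> /hq ->].
Qed.

Lemma fs_supp3 (f g h : fs) : exists2 r : seq G, uniq r &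
  forall s, s \notin r -> [/\ f s = 0, g s = 0 & h s = 0].
Proof.
have [r ur hr] := fs_supp2 f g; have [q uq hq] := fs_supp h.
exists (undup (r ++ q)) => [|s]; first exact: undup_uniq.
by rewrite mem_undup mem_cat => /norP[/hr[-> ->] /hq ->].
Qed.

Lemma fs_eqP (f g : fs) : (forall s, f s = g s) -> f = g.
Proof. by move=> h; apply: val_inj; apply/funext. Qed.

Lemma fsE_lin c (f g : fs) s : (c *: f + g) s = c *: f s + g s.
Proof. by []. Qed.

Lemma fs_sumE (I : Type) (r : seq I) (F : I -> fs) t :
  (\sum_(i <- r) F i) t = \sum_(i <- r) F i t.
Proof. by elim/big_ind2: _ => [|x1 x2 y1 y2 <- <-|]. Qed.

Lemma fs_of_seq_in (r : seq G) (f : G -> W) :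
  (fun s => if s \in r then f s else 0) \in fs_pred.
Proof.
rewrite inE /=; apply: (@sub_finite_set _ _ [set` r]) => [s /=|]; last exact: finite_seq.
by case: ifP => //; rewrite eqxx.
Qed.

Definition fs_of_seq r f : fs := MkFs (fs_of_seq_in r f).

Lemma fs_map_in (g : G -> W -> W) (f : fs) : (forall s, g s 0 = 0) ->
  (fun s => g s (f s)) \in fs_pred.
Proof.
move=> g0; rewrite inE /=; apply: sub_finite_set (set_mem (fs_in f)) => s /=.
by apply: contra_neq => ->.
Qed.

Lemma fs_shift_in (t : G) (g : W -> W) (f : fs) : g 0 = 0 ->
  (fun s => g (f (t^-1 * s)%g)) \in fs_pred.
Proof.
move=> g0; rewrite inE /=.
apply: (@sub_finite_set _ _ ((fun s => (t * s)%g) @` [set s | f s != 0])); last first.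
  by apply: finite_image; exact: set_mem (fs_in f).
move=> s /= h; exists (t^-1 * s)%g; last by rewrite mulgA mulgV mul1g.
by apply: contra h => /eqP ->; rewrite g0.
Qed.

End FinitelySupported.

Section TauLemmas.
Variables (R : realType) (G : groupType) (X : topologicalType) (al : haction G X).

Lemma tau_linear s c (f g : CX R X) : tau al s (c *: f + g) = c *: tau al s f + tau al s g.
Proof. exact: CX_eqP. Qed.

Lemma tauM_mul s (f g : CX R X) : tau al s (f * g) = tau al s f * tau al s g.
Proof. exact: CX_eqP. Qed.

Lemma tau_star s (f : CX R X) : CX_star (tau al s f) = tau al s (CX_star f).
Proof. exact: CX_eqP. Qed.

Lemma tau_tau s t (f : CX R X) : tau al s (tau al t f) = tau al (s * t)%g f.
Proof. by apply: CX_eqP => x /=; rewrite invgM actM. Qed.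

Lemma tau1 (f : CX R X) : tau al 1%g f = f.
Proof. by apply: CX_eqP => x /=; rewrite invg1 act1. Qed.

Lemma tau_one s : tau al s (1 : CX R X) = 1.
Proof. exact: CX_eqP. Qed.

End TauLemmas.

Section RegularRepresentation.
Variables (R : realType) (G : groupType) (X : topologicalType) (al : haction G X).
Variables (X_compact : compact [set: X]) (H : hilbert R) (rho : CX_rep X H).
Local Notation V := (fs G H).
Local Notation CX := (CX R X).
Local Open Scope complex_scope.

Definition reg_dot (u v : V) : R[i] := \sum_(t \in [set: G]) hdot H (u t) (v t).

Lemma reg_dot_seq (u v : V) (r : seq G) : uniq r -> (forall s, s \notin r -> u s = 0) ->
  reg_dot u v = \sum_(t <- r) hdot H (u t) (v t).
Proof. by move=> ur hr; apply: fsum_seq => // s /hr ->; rewrite linear0l. Qed.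

Lemma reg_dot_linear w c u v :
  reg_dot (c *: u + v) w = c * reg_dot u w + reg_dot v w.
Proof.
have [r ur hr] := fs_supp2 u v.
have h s : s \notin r -> (c *: u + v) s = 0.
  by move=> /hr[e1 e2]; rewrite fsE_lin e1 e2 scaler0 addr0.
rewrite (reg_dot_seq w ur h) !(reg_dot_seq w ur) => [|s /hr[]//|s /hr[]//].
rewrite mulr_sumr -big_split /=; apply: eq_bigr => s _.
exact: hdot_linear.
Qed.

Lemma reg_dot_herm u v : reg_dot u v = conjc (reg_dot v u).
Proof.
have [r ur hr] := fs_supp2 u v.
rewrite !(reg_dot_seq _ ur) => [|s /hr[]//|s /hr[]//].
by rewrite rmorph_sum; apply: eq_bigr => s _; exact: hdot_herm.
Qed.

Lemma reg_dot_ge0 u : 0 <= reg_dot u u.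
Proof.
have [r ur hr] := fs_supp u; rewrite (reg_dot_seq _ ur hr).
by apply: sumr_ge0 => s _; exact: hdot_ge0.
Qed.

Definition reg_ip : semi_inner V := SemiInner reg_dot_linear reg_dot_herm reg_dot_ge0.

Lemma sqr_snorm_reg (u : V) r : uniq r -> (forall s, s \notin r -> u s = 0) ->
  snorm reg_ip u ^+ 2 = \sum_(t <- r) hnorm (u t) ^+ 2.
Proof.
move=> ur hr; rewrite sqr_snorm /= (reg_dot_seq _ ur hr).
rewrite (big_morph _ (@ReD R) (erefl _ : complex.Re 0 = 0)).
by apply: eq_bigr => t _; rewrite -(sqr_snorm (hilbert_ip H)).
Qed.

Lemma rho_tau0 s f : rho (tau al s f) 0 = 0. Proof. exact: linear0. Qed.

Definition regL (f : CX) (u : V) : V :=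
  MkFs (@fs_map_in _ _ _ (fun t => rho (tau al t^-1%g f)) u
    (fun t => rho_tau0 t^-1%g f)).

Definition regU (s : G) (u : V) : V := MkFs (@fs_shift_in _ _ _ s id u erefl).

Lemma regL_linearl c f g v : regL (c *: f + g) v = c *: regL f v + regL g v.
Proof. by apply: fs_eqP => t; rewrite fsE_lin /= tau_linear rep_linearl. Qed.

Lemma regL_linearr f c u v : regL f (c *: u + v) = c *: regL f u + regL f v.
Proof. by apply: fs_eqP => t; rewrite fsE_lin /= linearP. Qed.

Lemma regLM f g v : regL (f * g) v = regL f (regL g v).
Proof. by apply: fs_eqP => t; rewrite /= tauM_mul (rep_mul rho). Qed.

Lemma regL_star f u v : reg_ip (regL f u) v = reg_ip u (regL (CX_star f) v).
Proof. by apply: eq_fsbigr => t _ /=; rewrite (rep_star rho) tau_star. Qed.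

(** The coordinate t is acted on by the translate of f by t^-1, so a bound uniform in t is needed;
    contractivity of rho supplies it. *)
Lemma regL_bounded f : exists2 M, 0 <= M &
  forall v, snorm reg_ip (regL f v) <= M * snorm reg_ip v.
Proof.
have [M M0 hM] := CX_bounded f X_compact; exists M => // v.
rewrite -(@ler_pXn2r _ 2) ?nnegrE ?mulr_ge0 ?snorm_ge0 // exprMn.
have [r ur hr] := fs_supp v.
rewrite !(sqr_snorm_reg ur) // => [|s /hr /= ->]; last exact: linear0.
rewrite mulr_sumr; apply: ler_sum => t _ /=.
rewrite -exprMn ler_pXn2r ?nnegrE ?mulr_ge0 ?sqrtr_ge0 //.
by apply: rep_contractive => // x; exact: hM.
Qed.

Lemma regU_linear s c u v : regU s (c *: u + v) = c *: regU s u + regU s v.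
Proof. exact: fs_eqP. Qed.

Lemma regU1 v : regU 1%g v = v.
Proof. by apply: fs_eqP => t /=; rewrite invg1 mul1g. Qed.

Lemma regUM s t v : regU (s * t)%g v = regU s (regU t v).
Proof. by apply: fs_eqP => x /=; rewrite invgM mulgA. Qed.

Lemma regU_star s u v : reg_ip (regU s u) v = reg_ip u (regU s^-1%g v).
Proof.
rewrite /= /reg_dot (reindex_fsbig _ _ _ _ (bij_mulg s)).
by apply: eq_fsbigr => t _ /=; rewrite mulgA mulVg mul1g invgK.
Qed.

Lemma regUL s f v : regU s (regL f v) = regL (tau al s f) (regU s v).
Proof. by apply: fs_eqP => t /=; rewrite tau_tau invgM invgK. Qed.

Definition reg_cov : cov_rep al reg_ip :=
  CovRep regL_linearl regL_linearr regLM regL_star regL_bounded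
    regU_linear regU1 regUM regU_star regUL.

Local Notation pi := (integ_rep reg_cov).

Lemma integ_regE (a : Cc R G X) (u : V) t : pi a u t = regular_rep al rho a u t.
Proof.
have [r ur hr] := Cc_supp a; rewrite [pi a u](integ_seq _ _ ur hr) fs_sumE.
rewrite /regular_rep (fsum_seq ur) // => s /hr ->.
by rewrite tau0 rep0l.
Qed.

(** The reduced norm ranges over all of l^2(G, H), but a finite partial sum of |a xi|^2 sees only
    finitely many values of xi, so xi may be truncated to a finitely supported vector. *)
Lemma reduced_norm_le a : (reduced_norm al rho a <= (pnorm pi a)%:E)%E.
Proof.
apply: ge_ereal_sup => _ [xi /= xi1 <-].
have p0 : 0 <= pnorm pi a := pnorm_ge0 pi a.
have -> : (pnorm pi a)%:E = sqrte ((pnorm pi a) ^+ 2)%:E by rewrite /= sqrtr_sqr ger0_norm.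
rewrite lee_sqrt ?lee_fin ?sqr_ge0 //.
apply: ge_ereal_sup => _ [A [finA _] <-].
have [ra ura ha] := Cc_supp a.
pose rA : seq G := finmap.enum_fset (fset_set A).
have urA : uniq rA by exact: finmap.fset_uniq.
(* The arguments s^-1 t at which xi is evaluated, for s in the support of a and t in A. *)
pose q := undup [seq (p.1^-1 * p.2)%g | p <- [seq (x, y) | x <- ra, y <- rA]].
have uq : uniq q by exact: undup_uniq.
pose u : V := fs_of_seq q xi.
have uE t : t \in rA -> regular_rep al rho a xi t = pi a u t.
  move=> tA; rewrite integ_regE /regular_rep.
  have z s : s \notin ra -> rho (tau al t^-1%g (a s)) = 0 :> (H -> H).
    move=> /ha ->; rewrite tau0; apply/funext => v.
    exact: rep0l.
  rewrite !(fsum_seq ura) //=; last 2 first.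
  - by move=> s /z ->.
  - by move=> s /z ->.
  apply: eq_big_seq => s sa; rewrite ifT // mem_undup.
  apply/mapP; exists (s, t) => //; apply/allpairsP; by exists (s, t).
rewrite fsbig_finite //= sumEFin lee_fin.
rewrite (eq_big_seq (fun t => hnorm (pi a u t) ^+ 2)); last by move=> t /uE ->.
have [r ur hr] := fs_supp (pi a u).
apply: (@le_trans _ _ (snorm reg_ip (pi a u) ^+ 2)).
  pose r' := undup (r ++ rA).
  have ur' : uniq r' by exact: undup_uniq.
  rewrite (sqr_snorm_reg ur'); last first.
    by move=> s; rewrite mem_undup mem_cat => /norP[/hr].
  rewrite [leRHS](bigID (mem rA)) /= -[leLHS]addr0 lerD ?sumr_ge0 //; last first.
    by move=> *; exact: sqr_ge0.
  rewrite -[leRHS]big_filter le_eqVlt; apply/orP; left; apply/eqP.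
  apply: perm_big; apply: uniq_perm => //; first exact: filter_uniq.
  by move=> s; rewrite mem_filter mem_undup mem_cat; case: (s \in rA); rewrite ?orbT.
rewrite ler_pXn2r ?nnegrE ?snorm_ge0 //.
apply: le_trans (snorm_prep pi a u) _; rewrite ler_piMr //.
rewrite -(@ler_pXn2r _ 2) ?nnegrE ?snorm_ge0 ?ler01 // expr1n.
rewrite (sqr_snorm_reg uq); last by move=> s /= /negbTE ->.
rewrite -lee_fin -sumEFin; apply: le_trans _ xi1.
rewrite (eq_big_seq (fun t => (hnorm (xi t) ^+ 2)%:E)); last by move=> t /= ->.
rewrite fsbig_seq //; apply: ereal_sup_ubound; exists [set` q] => //.
by split => //; exact: finite_seq.
Qed.

(** On the vector v placed at the identity, the coordinate s of the image is rho (tau_(s^-1) (a s))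
    v. *)
Lemma pnorm_reg_eq0 a : faithful rho -> pnorm pi a = 0 -> a = 0.
Proof.
move=> rf p0; apply: val_inj; apply/funext => s /=.
have e : tau al s^-1%g (a s) = 0.
  apply: rf => v.
  pose u : V := fs_of_seq [:: 1%g] (fun _ => v).
  have : snorm reg_ip (pi a u) = 0.
    apply/le_anti; rewrite snorm_ge0 andbT.
    by have := snorm_prep pi a u; rewrite p0 mul0r.
  move=> /(congr1 (fun x => x ^+ 2)); rewrite expr0n /=.
  have [r ur hr] := fs_supp (pi a u).
  rewrite (sqr_snorm_reg ur hr) => /eqP.
  rewrite psumr_eq0; last by move=> *; exact: sqr_ge0.
  move=> /allP h.
  have : pi a u s = 0.
    have [sr|/hr//] := boolP (s \in r).
    have := h s sr => /=; rewrite sqrf_eq0 sqrtr_eq0 => h0.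
    have h1 : hdot H (pi a u s) (pi a u s) = 0.
      rewrite (ge0cE (hdot_ge0 _)); congr (_%:C); apply/le_anti; rewrite h0.
      by rewrite ge0_Re ?hdot_ge0.
    by apply/eqP; rewrite -(dnorm_eq0 (hdot H)) h1.
  rewrite integ_regE /regular_rep (fsum_seq (L := [:: s])) //; last first.
    move=> t; rewrite inE => ts; rewrite /= inE.
    rewrite ifF ?linear0 //; apply/negbTE; apply: contra ts => /eqP e.
    by rewrite -(mulg1 t) -e mulgA mulgV mul1g.
  rewrite big_seq1 /= mulVg inE eqxx => ->.
  by rewrite rep0l.
by rewrite -(tau1 al (a s)) -(mulgV s) -tau_tau e tau0.
Qed.

End RegularRepresentation.

(** * The word length on the free group *)

Section FreeGroupLength.
Variable T : choiceType.
Implicit Types (x y v : seq (letter T)) (l : letter T) (g h : free_group T).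

Definition wlen g : nat := size (fword g).

(** Computes y^-1 x by cancelling the letters of y from the front, which allows induction along y
    rather than along its reversed inverse. *)
Definition lquot y x := foldl (fun z l => lcons (linv l) z) x y.

Lemma fword_invM g h : fword (g^-1 * h)%g = lquot (fword g) (fword h).
Proof.
rewrite /= /lquot -[fword g in RHS]revK foldl_rev -map_rev.
by elim: (rev (fword g)) => //= l w ->.
Qed.

Definition diverge x y : bool :=
  if x is l :: _ then if y is m :: _ then l != m else true else true.

(** After [linv m] is put in front, the next letter of y still cannot cancel, because y is
    reduced. *)
Lemma size_lquot_diverge y x : reduced y -> diverge x y ->
  size (lquot y x) = (size x + size y)%N.
Proof.
elim: y x => [|m y IH] x /=; first by rewrite addn0.
move=> ry dxy; have -> : lcons (linv m) x = linv m :: x.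
  by case: x dxy => //= l x lm; rewrite linvK (negbTE lm).
rewrite IH ?addnS ?addSn //=; first exact: path_sorted ry.
by case: y ry {IH dxy} => //= k y /andP[km _]; rewrite eq_sym.
Qed.

Fixpoint common_prefix x y : nat :=
  match x, y with
  | l :: x', m :: y' => if l == m then (common_prefix x' y').+1 else 0
  | _, _ => 0
  end.

Lemma common_prefix_le x y :
  (common_prefix x y <= size x)%N /\ (common_prefix x y <= size y)%N.
Proof.
elim: x y => [|l x IH] [|m y] //=; case: ifP => //= _.
by have [h1 h2] := IH y; split.
Qed.

(** The geodesic between x and y in the tree passes through their longest common prefix. The
    additive form avoids truncated subtraction. *)
Lemma size_lquot y x : reduced y ->
  (size (lquot y x) + (common_prefix x y).*2 = size x + size y)%N.
Proof.
elim: y x => [|m y IH] [|l x] ry.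
- by [].
- by rewrite /= !addn0.
- by rewrite size_lquot_diverge // addn0.
have [<-|lm] := eqVneq l m; last first.
  by rewrite size_lquot_diverge //= (negbTE lm) addn0.
rewrite /lquot [foldl _ _ _]/= linvK eqxx [common_prefix _ _]/= eqxx doubleS !addnS.
by rewrite IH; [rewrite /= ?addSn ?addnS|exact: path_sorted ry].
Qed.

Lemma prefix_common v x y :
  prefix v x && prefix v y = (size v <= common_prefix x y)%N && prefix v x.
Proof.
elim: v x y => [|k v IH] [|l x] [|m y] //=; rewrite ?andbF //.
have [<-|lm] := eqVneq l m; last first.
  by rewrite ltn0 /=; case: eqVneq => [->|] //=; rewrite (negbTE lm) andbF.
by rewrite ltnS; case: eqVneq => //=; rewrite andbF.
Qed.

Lemma wlenM g h : (wlen (g * h)%g <= wlen g + wlen h)%N.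
Proof.
rewrite /wlen /=; elim: (fword g) => //= l w IH; rewrite addSn.
apply: leq_trans (_ : _ <= (size (foldr (@lcons T) h w)).+1)%N _; last by rewrite ltnS.
by case: (foldr _ _ _) => //= k z; case: ifP => //= _; exact: leqW.
Qed.

Lemma wlenV g : wlen g^-1%g = wlen g.
Proof. by rewrite /wlen /= size_rev size_map. Qed.

Lemma wlen_conj g s t : (wlen g <= wlen (t^-1 * (g * s))%g + (wlen t + wlen s))%N.
Proof.
have {1}-> : g = (t * (t^-1 * (g * s)) * s^-1)%g.
  by rewrite !mulgA mulgV mul1g -mulgA mulgV mulg1.
apply: leq_trans (wlenM _ _) _; rewrite wlenV addnA leq_add2r addnC.
exact: leq_trans (wlenM _ _) _.
Qed.

Variable R : realType.
Implicit Type r : R.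

(** The sum telescopes, as (1 - r^2) r^(N - 2i) = r^(N - 2i) - r^(N - 2(i - 1)). *)
Lemma geometric_prefix_sum r (N m : nat) : (m.*2 <= N)%N ->
  \sum_(0 <= i < m.+1) (if i == 0 then 1 else 1 - r ^+ 2) * r ^+ (N - i.*2) =
  r ^+ (N - m.*2).
Proof.
elim: m => [|m IH] mN; first by rewrite big_nat1 /= mul1r.
rewrite big_nat_recr //= IH; last first.
  by apply: leq_trans mN; rewrite doubleS; do 2 apply: leqW.
have -> : (N - m.*2 = (N - m.+1.*2).+2)%N.
  by rewrite doubleS -[in LHS](subnK mN) doubleS -!addSnnS addnK.
by rewrite !exprS; ring.
Qed.

Definition prefix_weight v r : R := if size v == 0 then 1 else 1 - r ^+ 2.

Definition prefix_vec r v x : R := if prefix v x then r ^+ (size x - size v) else 0.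

(** P is arbitrary so that one list can serve all pairs from a finite set, which allows sums to be
    exchanged in [kfun_ge0]. *)
Lemma prefix_sumE r x y (P : seq (seq (letter T))) :
  uniq P -> (forall v, prefix v x -> v \in P) ->
  \sum_(v <- P) prefix_weight v r * prefix_vec r v x * prefix_vec r v y =
  r ^+ (size x + size y - (common_prefix x y).*2).
Proof.
move=> uP hP; set m := common_prefix x y.
have [mx my] : (m <= size x)%N /\ (m <= size y)%N := common_prefix_le x y.
rewrite -(@geometric_prefix_sum r _ m); last by rewrite -addnn leq_add.
pose F v := prefix_weight v r * r ^+ (size x + size y - (size v).*2).
transitivity (\sum_(v <- P | (size v <= m)%N && prefix v x) F v).
  rewrite [RHS]big_mkcond; apply: eq_bigr => v _; rewrite -prefix_common /prefix_vec.
  case: ifP => [vx|]; last by rewrite /= mulr0 mul0r.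
  case: ifP => [vy|]; last by rewrite /= mulr0.
  rewrite /= /F -mulrA -exprD; congr (_ * r ^+ _).
  have sx : (size v <= size x)%N.
    by have := vx; rewrite prefixE => /eqP <-; rewrite size_take_min geq_minr.
  have sy : (size v <= size y)%N.
    by have := vy; rewrite prefixE => /eqP <-; rewrite size_take_min geq_minr.
  by rewrite -addnn subnDA addnBAC // addnBA.
rewrite -big_filter (perm_big [seq take i x | i <- index_iota 0 m.+1]).
  rewrite big_map; apply: eq_big_nat => i /andP[_ im].
  rewrite /F /prefix_weight size_takel //.
  exact: leq_trans mx.
have st i : (i <= m)%N -> size (take i x) = i.
  by move=> im; rewrite size_takel // (leq_trans im).
apply: uniq_perm; first exact: filter_uniq.
  rewrite map_inj_in_uniq ?iota_uniq // => i j.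
  rewrite !mem_index_iota !ltnS /= => im jm /(congr1 size).
  by rewrite !st.
move=> v; rewrite mem_filter; apply/idP/mapP => [/andP[/andP[vm]]|[k]].
  rewrite prefixE => /eqP vx _; exists (size v) => //.
  by rewrite mem_index_iota ltnS.
rewrite mem_index_iota ltnS /= => km ->.
by rewrite st // km prefix_take /= hP ?prefix_take.
Qed.

Definition kernel r g h : R := r ^+ wlen (h^-1 * g)%g.

Lemma kernel_prefix r g h (P : seq (seq (letter T))) :
  uniq P -> (forall v, prefix v g -> v \in P) ->
  kernel r g h =
  \sum_(v <- P) prefix_weight v r * prefix_vec r v g * prefix_vec r v h.
Proof.
move=> uP hP; rewrite prefix_sumE // /kernel /wlen fword_invM.
by rewrite -size_lquot ?fword_reduced // addnK.
Qed.

Lemma kernelC r g h : kernel r g h = kernel r h g.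
Proof. by rewrite /kernel -wlenV invgM invgK. Qed.

Lemma kernel_shift r s g h : kernel r (s * g)%g h = kernel r g (s^-1 * h)%g.
Proof. by rewrite /kernel invgM invgK mulgA. Qed.

Lemma kernel_ge0 r g h : 0 <= r -> 0 <= kernel r g h.
Proof. by move=> r0; rewrite exprn_ge0. Qed.

(** Triangle inequality: |g| <= |t^-1 g s| + |t| + |s|. *)
Lemma kernel_decay r g s t : 0 < r -> r <= 1 ->
  kernel r (g * s)%g t * r ^+ (wlen t + wlen s) <= r ^+ wlen g.
Proof.
move=> r0 r1; rewrite /kernel -exprD ler_wiXn2l ?wlen_conj //.
exact: ltW.
Qed.

Lemma all_prefixes (L : seq (free_group T)) : exists2 P : seq (seq (letter T)),
  uniq P & forall g, g \in L -> forall v, prefix v g -> v \in P.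
Proof.
exists (undup (flatten
  [seq [seq take i (fword g) | i <- iota 0 (size (fword g)).+1] | g <- L])).
  exact: undup_uniq.
move=> g gL v vg; rewrite mem_undup; apply/flattenP.
exists [seq take i (fword g) | i <- iota 0 (size (fword g)).+1]; first exact: map_f.
have := vg; rewrite prefixE => /eqP e; apply/mapP; exists (size v) => //.
by rewrite mem_iota /= add0n ltnS -{1}e size_take_min geq_minr.
Qed.

End FreeGroupLength.

(** * The adjacency operator of the 4-regular tree on radial functions *)

Section Generators.
Variable R : realType.
Implicit Types r : R.

Definition gen (l : letter bool) : F2 := @FreeGroup bool [:: l] isT.

Definition letters : seq (letter bool) :=
  [:: (true, true); (true, false); (false, true); (false, false)].

(** Each vertex other than the root has one neighbour nearer to the root and three farther away. *)
Lemma sum_gen (phi : nat -> R) (g : F2) :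
  \sum_(l <- letters) phi (wlen (gen l * g)%g) =
  if wlen g is n.+1 then phi n + 3 * phi n.+2 else 4 * phi 1.
Proof.
rewrite /wlen /= !big_cons big_nil /=; case: (fword g) => [|[a b] w] /=; first by ring.
by case: a; case: b => /=; ring.
Qed.

Definition lam r : R := 3 * r + r^-1.

(** Away from the root this is an equality; at the root it reads 4r <= 3r + 1/r. *)
Lemma sum_gen_le r (g : F2) : 0 < r -> r <= 1 ->
  \sum_(l <- letters) r ^+ wlen (gen l * g)%g <= lam r * r ^+ wlen g.
Proof.
move=> r0 r1; rewrite (sum_gen (fun n => r ^+ n)) /lam.
case: (wlen g) => [|n].
  rewrite expr0 expr1 mulr1; have : r <= r^-1.
    by rewrite -(ler_pM2r r0) mulVf ?gt_eqF // -expr2 exprn_ile1 // ltW.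
  by lra.
by rewrite le_eqVlt; apply/orP; left; apply/eqP; rewrite !exprS; field; rewrite gt_eqF.
Qed.

(* The radial eigenfunction of the adjacency operator of the 4-regular tree for
   the eigenvalue [lam r]: both r^n and t^n with t = 1/(3r) are eigenfunctions
   away from the root, and the coefficient is chosen to fix the root. *)
Definition sph_coef r : R := (r^-1 - r) / (3 * r - (3 * r)^-1).
Definition spherical r (n : nat) : R := r ^+ n - sph_coef r * ((3 * r)^-1) ^+ n.

(** The upper bound amounts to r^2 > 1/3. It makes [spherical] positive at the root, while the lower
    bound keeps [spherical] below r^n. *)
Lemma sph_coef_bounds r : 2 / 3 < r -> r < 1 -> 0 <= sph_coef r /\ sph_coef r < 1.
Proof.
move=> r0 r1; have rp : 0 < r by lra.
have r2 : 4 / 9 < r ^+ 2 by nra.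
have d0 : 0 < 3 * r - (3 * r)^-1.
  have -> : 3 * r - (3 * r)^-1 = (9 * r ^+ 2 - 1) / (3 * r) by field; lra.
  by rewrite divr_gt0 //; lra.
split.
  rewrite divr_ge0 ?(ltW d0) //.
  have -> : r^-1 - r = (1 - r ^+ 2) / r by field; lra.
  by rewrite divr_ge0 ?(ltW rp) //; nra.
rewrite /sph_coef ltr_pdivrMr // mul1r -subr_gt0.
have -> : 3 * r - (3 * r)^-1 - (r^-1 - r) = (12 * r ^+ 2 - 4) / (3 * r) by field; lra.
by rewrite divr_gt0 //; lra.
Qed.

Lemma sum_spherical r (g : F2) : 2 / 3 < r -> r < 1 ->
  \sum_(l <- letters) spherical r (wlen (gen l * g)%g) = lam r * spherical r (wlen g).
Proof.
move=> r0 r1; have rp : 0 < r by lra.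
have r2 : 3 * r * (3 * r) - 1 != 0 by apply: lt0r_neq0; nra.
rewrite sum_gen /spherical /lam; case: (wlen g) => [|n].
  by rewrite !expr0 !expr1 /sph_coef; field; rewrite r2 gt_eqF.
rewrite !exprS; set c := sph_coef r.
have -> : (3 * r)^-1 = 3^-1 * r^-1 by field; lra.
set p := r ^+ n; set q := (3^-1 * r^-1) ^+ n.
by field; rewrite gt_eqF.
Qed.

Lemma spherical_le r n : 2 / 3 < r -> r < 1 -> spherical r n <= r ^+ n.
Proof.
move=> r0 r1; have [c0 _] := sph_coef_bounds r0 r1.
rewrite /spherical lerBlDr lerDl mulr_ge0 // exprn_ge0 // invr_ge0; lra.
Qed.

Lemma spherical0 r : 2 / 3 < r -> r < 1 -> 0 < spherical r 0.
Proof.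
move=> r0 r1; have [_ c1] := sph_coef_bounds r0 r1.
by rewrite /spherical !expr0 mulr1 subr_gt0.
Qed.

Lemma lam_inj r r' : 2 / 3 < r -> 2 / 3 < r' -> lam r = lam r' -> r = r'.
Proof.
move=> r0 r'0 e; have rp : 0 < r by lra.
have r'p : 0 < r' by lra.
have p : 0 < r * r' by exact: mulr_gt0.
have : (r - r') * (3 * (r * r') - 1) = 0.
  have -> : (r - r') * (3 * (r * r') - 1) = (lam r - lam r') * (r * r').
    by rewrite /lam; field; rewrite !gt_eqF.
  by rewrite e subrr mul0r.
move/eqP; rewrite mulf_eq0 subr_eq0 => /orP[/eqP//|/eqP h].
have : 4 / 9 < r * r' by nra.
by lra.
Qed.

End Generators.

(** * The state of an invariant measure *)

Section InvariantState.
Variables (R : realType) (G : groupType) (X : topologicalType) (al : haction G X).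

(** Collects what the kernel representation uses of the measure. *)
Record inv_state := InvState {
  st :> CX R X -> R[i];
  st_linear : forall c f g, st (c *: f + g) = c * st f + st g;
  st_ge0 : forall f : CX R X, (forall x, 0 <= f x) -> 0 <= st f;
  st_star : forall f, st (CX_star f) = conjc (st f);
  st_tau : forall s f, st (tau al s f) = st f;
  st1 : st 1 = 1 }.

End InvariantState.

Section IntegralState.
Variables (R : realType) (X : ptopologicalType) (G : groupType) (al : haction G X).
Hypothesis X_compact : compact [set: X].
Variables (mu : probability (borel X) R) (mu_invariant : invariant_measure al mu).
Local Open Scope complex_scope.
Implicit Types (h k l : X -> R) (f g : CX R X).

Lemma borel_measurable h : continuous h ->
  measurable_fun [set: borel X] (h : borel X -> R).
Proof.
move=> /continuousP ch; apply: (measurability _ (RGenOpens.measurableE R)).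
move=> _ [_ [a [b ->] <-]]; rewrite setTI.
by apply: sub_sigma_algebra; apply: ch; exact: interval_open.
Qed.

Lemma continuous_integrable h : continuous h ->
  mu.-integrable [set: borel X] (EFin \o (h : borel X -> R)).
Proof.
move=> ch; apply: measurable_bounded_integrable => //.
- exact: le_lt_trans (probability_le1 mu measurableT) (ltry 1).
- exact: borel_measurable.
have : compact (h @` [set: X]).
  by apply: continuous_compact => //; exact: continuous_subspaceT.
move=> /compact_bounded[N [Nr hN]]; exists N; split => // M NM x _.
by apply: hN NM _ _; exists x.
Qed.

Definition rint h : R := Rintegral mu [set: borel X] (h : borel X -> R).

Lemma rintD h k : continuous h -> continuous k ->
  rint (fun x => h x + k x) = rint h + rint k.
Proof. by move=> ch ck; apply: RintegralD => //; exact: continuous_integrable. Qed.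

Lemma rintZ a h : continuous h -> rint (fun x => a * h x) = a * rint h.
Proof. by move=> ch; apply: RintegralZl => //; exact: continuous_integrable. Qed.

(** Change of variables: by invariance the image of mu under [al s] is mu. *)
Lemma rint_act s h : continuous h -> rint (fun x => h (al s x)) = rint h.
Proof.
move=> ch; rewrite /rint /Rintegral; congr fine.
have ma : measurable_fun [set: borel X] (al s : borel X -> borel X).
  have gE : @measurable _ (borel X) = <<s (@open X) >> by [].
  apply: (measurability _ gE) => _ [U oU <-]; rewrite setTI.
  apply: sub_sigma_algebra.
  by have /continuousP := @act_continuous G X al s; exact.
have cs : continuous (h \o al s).
  by move=> x; apply: continuous_comp; [exact: act_continuous|exact: ch].
have /measurable_EFinP mh := borel_measurable ch.
have := integral_pushforward ma mh (continuous_integrable cs) measurableT.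
rewrite preimage_setT => <-; apply: eq_measure_integral => A mA _.
exact: mu_invariant.
Qed.

Lemma Re_cts f : continuous (fun x => complex.Re (f x)).
Proof.
apply: (CX_lipschitz_continuous (phi := @complex.Re R)) => z w.
by rewrite -ReN -ReD Re_cmod.
Qed.

Lemma Im_cts f : continuous (fun x => complex.Im (f x)).
Proof.
apply: (CX_lipschitz_continuous (phi := @complex.Im R)) => z w.
by rewrite -ImN -ImD Im_cmod.
Qed.

Definition cint f : R[i] :=
  rint (fun x => complex.Re (f x)) +i* rint (fun x => complex.Im (f x)).

Lemma rint_lin3 (a b : R) h k l : continuous h -> continuous k -> continuous l ->
  rint (fun x => a * h x + b * k x + l x) = a * rint h + b * rint k + rint l.
Proof.
move=> ch ck cl.
have cZ (c : R) (m : X -> R) : continuous m -> continuous (fun x => c * m x).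
  by move=> cm x; apply: cvgM; [exact: cvg_cst|exact: cm].
rewrite rintD ?rintD ?rintZ //; [exact: cZ|exact: cZ|move=> x].
by apply: cvgD; exact: cZ.
Qed.

Lemma cint_linear c f g : cint (c *: f + g) = c * cint f + cint g.
Proof.
case: c => a b; apply/eqP; rewrite eq_complex /cint; apply/andP; split; apply/eqP => /=.
  rewrite -mulNr -rint_lin3; [|exact: Re_cts|exact: Im_cts|exact: Re_cts].
  congr rint; apply/funext => x; rewrite -[LHS]/(complex.Re ((a +i* b) * f x + g x)) ReD.
  by case: (f x) => p q /=; rewrite mulNr.
rewrite -rint_lin3; [|exact: Im_cts|exact: Re_cts|exact: Im_cts].
congr rint; apply/funext => x; rewrite -[LHS]/(complex.Im ((a +i* b) * f x + g x)) ImD.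
by case: (f x) => p q /=.
Qed.

Lemma rint_eq0 : rint (fun=> 0) = 0.
Proof. by rewrite /rint Rintegral_cst // mul0r. Qed.

Lemma cint_ge0 f : (forall x, 0 <= f x) -> 0 <= cint f.
Proof.
move=> f0; rewrite /cint.
have -> : (fun x => complex.Im (f x)) = (fun=> 0).
  by apply/funext => x; rewrite ger0_Im.
rewrite rint_eq0 complexr0 ler0c; apply: Rintegral_ge0 => x _.
exact: ge0_Re.
Qed.

Lemma cint_star f : cint (CX_star f) = conjc (cint f).
Proof.
rewrite /cint /=; congr Complex; first by congr rint; apply/funext => x; rewrite ReJ.
rewrite -mulN1r -rintZ; last exact: Im_cts.
by congr rint; apply/funext => x; case: (f x) => a b /=; rewrite mulN1r.
Qed.

Lemma cint_tau s f : cint (tau al s f) = cint f.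
Proof.
rewrite /cint /=; congr Complex.
  exact: (rint_act s^-1%g (@Re_cts f)).
exact: (rint_act s^-1%g (@Im_cts f)).
Qed.

Lemma cint1 : cint 1 = 1.
Proof.
rewrite /cint; apply/eqP; rewrite eq_complex; apply/andP; split; apply/eqP => /=.
  rewrite /rint Rintegral_cst // mul1r.
  exact: (congr1 fine (probability_setT mu)).
exact: rint_eq0.
Qed.

Definition int_state : inv_state R al :=
  InvState cint_linear cint_ge0 cint_star cint_tau cint1.

End IntegralState.

(** * The representation attached to r^|g| *)

Section KernelRepresentation.
Variables (R : realType) (X : topologicalType) (al : haction F2 X).
Hypothesis X_compact : compact [set: X].
Variables (I : inv_state R al) (r : R).
Hypotheses (r_gt0 : 0 < r) (r_lt1 : r < 1).
Local Notation CX := (CX R X).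
Local Notation V := (fs F2 CX).
Local Open Scope complex_scope.

Lemma st_sum (J : Type) (s : seq J) (F : J -> CX) :
  I (\sum_(i <- s) F i) = \sum_(i <- s) I (F i).
Proof.
have I0 : I 0 = 0.
  have := st_linear I 1 0 0; rewrite !scale1r addr0 mul1r => /eqP.
  by rewrite addrC -subr_eq subrr => /eqP.
elim: s => [|i s IH]; rewrite ?big_nil // !big_cons -IH.
by have := st_linear I 1 (F i) (\sum_(j <- s) F j); rewrite !scale1r mul1r.
Qed.

Lemma stZ c (f : CX) : I (c *: f) = c * I f.
Proof.
have I0 : I 0 = 0 by have := st_sum [::] (fun _ : nat => 0); rewrite !big_nil.
by have := st_linear I c f 0; rewrite !addr0 I0 addr0.
Qed.

Lemma CX_sumE (J : Type) (s : seq J) (F : J -> CX) x :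
  (\sum_(i <- s) F i) x = \sum_(i <- s) F i x.
Proof. by elim/big_ind2: _ => [|x1 x2 y1 y2 <- <-|]. Qed.

Lemma CX_starK (f : CX) : CX_star (CX_star f) = f.
Proof. by apply: CX_eqP => x; exact: conjcK. Qed.

Lemma CX_starM (f g : CX) : CX_star (f * g) = CX_star f * CX_star g.
Proof. by apply: CX_eqP => x; rewrite [RHS]CXE_mul /= -conjcM -CXE_mul. Qed.

Lemma st_ip_linear (g : CX) (c : R[i]) (f h : CX) :
  I ((c *: f + h) * CX_star g) = c * I (f * CX_star g) + I (h * CX_star g).
Proof.
rewrite -st_linear; congr (I _); apply: CX_eqP => x.
by rewrite CXE_add CXE_scale !CXE_mul CXE_add CXE_scale mulrDl mulrA.
Qed.

Lemma st_ip_herm (f g : CX) : I (f * CX_star g) = conjc (I (g * CX_star f)).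
Proof. by rewrite -st_star CX_starM CX_starK mulrC. Qed.

Lemma st_ip_ge0 (f : CX) : 0 <= I (f * CX_star f).
Proof. by apply: st_ge0 => x; rewrite CXE_mul; exact: mulcJ_ge0. Qed.

Definition st_ip : semi_inner CX := SemiInner st_ip_linear st_ip_herm st_ip_ge0.

Lemma snorm_tau s (f : CX) : snorm st_ip (tau al s f) = snorm st_ip f.
Proof. by rewrite /snorm /= tau_star -tauM_mul st_tau. Qed.

(** The GNS form phi(b^* a) of the state phi(a) = sum_g r^|g| I(a g); invariance of I removes the
    translation by t^-1 that b^* introduces. Accordingly [kL] and [kU] are left multiplications. *)
Definition kdot (a b : V) : R[i] :=
  \sum_(s \in [set: F2]) \sum_(t \in [set: F2]) (kernel r s t)%:C * st_ip (a s) (b t).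

Lemma kdot_seq (a b : V) (L M : seq F2) : uniq L -> uniq M ->
  (forall s, s \notin L -> a s = 0) -> (forall s, s \notin M -> b s = 0) ->
  kdot a b = \sum_(s <- L) \sum_(t <- M) (kernel r s t)%:C * st_ip (a s) (b t).
Proof.
move=> uL uM hL hM; rewrite /kdot (fsum_seq uL) => [|s /hL as0]; last first.
  by apply: fsbig1 => t _; rewrite as0 ip0l mulr0.
by apply: eq_bigr => s _; rewrite (fsum_seq uM) // => t /hM ->; rewrite ip0r mulr0.
Qed.

Lemma kdot_linear (w : V) c u v : kdot (c *: u + v) w = c * kdot u w + kdot v w.
Proof.
have [L uL hL] := fs_supp3 u v w.
have hu s : s \notin L -> u s = 0 by case/hL.
have hv s : s \notin L -> v s = 0 by case/hL.
have hw s : s \notin L -> w s = 0 by case/hL.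
have huv s : s \notin L -> (c *: u + v) s = 0.
  by move=> /hL[e1 e2 _]; rewrite fsE_lin e1 e2 scaler0 addr0.
rewrite (kdot_seq uL uL huv hw) (kdot_seq uL uL hu hw) (kdot_seq uL uL hv hw).
rewrite mulr_sumr -big_split; apply: eq_bigr => s _ /=.
rewrite mulr_sumr -big_split; apply: eq_bigr => t _ /=.
have := st_ip_linear (w t) c (u s) (v s) => /= ->; ring.
Qed.

Lemma kdot_herm (u v : V) : kdot u v = conjc (kdot v u).
Proof.
have [L uL hL] := fs_supp2 u v.
have hu s : s \notin L -> u s = 0 by case/hL.
have hv s : s \notin L -> v s = 0 by case/hL.
rewrite (kdot_seq uL uL hu hv) (kdot_seq uL uL hv hu) exchange_big conjc_sum.
apply: eq_bigr => s _; rewrite conjc_sum; apply: eq_bigr => t _.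
by rewrite conjcM conjc_real -st_ip_herm kernelC.
Qed.

(* Pointwise in x, the kernel form is a sum of squares over the common
   prefixes of s and t. *)
Definition kfun (a : V) (L : seq F2) : CX :=
  \sum_(s <- L) \sum_(t <- L) (kernel r s t)%:C *: (a s * CX_star (a t)).

Lemma kfunE a L x : kfun a L x =
  \sum_(s <- L) \sum_(t <- L) (kernel r s t)%:C * (a s x * conjc (a t x)).
Proof.
by rewrite /kfun CX_sumE; apply: eq_bigr => s _; rewrite CX_sumE.
Qed.

Lemma kfun_ge0 a L x : 0 <= kfun a L x.
Proof.
have [P uP hP] := all_prefixes L.
have -> : kfun a L x = \sum_(v <- P) (prefix_weight v r)%:C *
    ((\sum_(s <- L) (prefix_vec r v s)%:C * a s x) *
     conjc (\sum_(s <- L) (prefix_vec r v s)%:C * a s x)).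
  rewrite kfunE.
  transitivity (\sum_(s <- L) \sum_(t <- L) \sum_(v <- P)
     (prefix_weight v r)%:C * (((prefix_vec r v s)%:C * a s x) *
       conjc ((prefix_vec r v t)%:C * a t x))).
    apply: eq_big_seq => s sL; apply: eq_bigr => t _.
    rewrite (kernel_prefix r t uP (hP s sL)) rmorph_sum mulr_suml.
    by apply: eq_bigr => v _; rewrite conjcM conjc_real !rmorphM; ring.
  under eq_bigr do rewrite exchange_big.
  rewrite exchange_big; apply: eq_bigr => v _ /=.
  rewrite conjc_sum mulr_suml mulr_sumr; apply: eq_bigr => s _.
  by rewrite !mulr_sumr.
apply: sumr_ge0 => v _; rewrite mulr_ge0 ?mulcJ_ge0 // ler0c /prefix_weight.
case: ifP => // _; rewrite subr_ge0 exprn_ile1 // ltW //.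
Qed.

Lemma kdot_kfun (a : V) (L : seq F2) : uniq L -> (forall s, s \notin L -> a s = 0) ->
  kdot a a = I (kfun a L).
Proof.
move=> uL hL; rewrite (kdot_seq uL uL hL hL) /kfun st_sum; apply: eq_bigr => s _.
by rewrite st_sum; apply: eq_bigr => t _; rewrite stZ.
Qed.

Lemma kdot_ge0 (u : V) : 0 <= kdot u u.
Proof.
have [L uL hL] := fs_supp u; rewrite (kdot_kfun uL hL).
by apply: st_ge0 => x; exact: kfun_ge0.
Qed.

Definition kip : semi_inner V := SemiInner kdot_linear kdot_herm kdot_ge0.

Lemma kL0 (f : CX) : f * 0 = 0. Proof. exact: mulr0. Qed.

Definition kL (f : CX) (u : V) : V :=
  MkFs (@fs_map_in R F2 CX (fun _ => *%R f) u (fun _ => kL0 f)).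

Definition kU (s : F2) (u : V) : V :=
  MkFs (@fs_shift_in R F2 CX s (tau al s) u (tau0 R al s)).

Lemma kL_linearl c f g v : kL (c *: f + g) v = c *: kL f v + kL g v.
Proof.
apply: fs_eqP => t; apply: CX_eqP => x; rewrite fsE_lin CXE_add CXE_scale.
by rewrite !CXE_mul CXE_add CXE_scale mulrDl mulrA.
Qed.

Lemma kL_linearr f c u v : kL f (c *: u + v) = c *: kL f u + kL f v.
Proof.
apply: fs_eqP => t; apply: CX_eqP => x; rewrite fsE_lin CXE_add CXE_scale.
by rewrite !CXE_mul fsE_lin CXE_add CXE_scale mulrDr mulrCA.
Qed.

Lemma kLM f g v : kL (f * g) v = kL f (kL g v).
Proof. by apply: fs_eqP => t; rewrite /= mulrA. Qed.

Lemma kL_star f u v : kip (kL f u) v = kip u (kL (CX_star f) v).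
Proof.
apply: eq_fsbigr => s _; apply: eq_fsbigr => t _ /=.
by rewrite CX_starM CX_starK mulrCA mulrA.
Qed.

(** Pointwise, multiplying v by f multiplies [kfun] by |f|^2 <= M^2; positivity of the state carries
    this to the form. *)
Lemma kL_bounded f : exists2 M, 0 <= M &
  forall v, snorm kip (kL f v) <= M * snorm kip v.
Proof.
have [M M0 hM] := CX_bounded f X_compact; exists M => // v.
rewrite -(@ler_pXn2r _ 2) ?nnegrE ?mulr_ge0 ?snorm_ge0 // exprMn.
have [L uL hL] := fs_supp v.
have hL' s : s \notin L -> kL f v s = 0 by move=> /hL /= ->; rewrite mulr0.
rewrite !sqr_snorm /= (kdot_kfun uL hL) (kdot_kfun uL hL').
rewrite -Re_rM -subr_ge0 -ReN -ReD; apply: ge0_Re.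
have -> : (M ^+ 2)%:C * I (kfun v L) - I (kfun (kL f v) L) =
    I ((- 1) *: kfun (kL f v) L + (M ^+ 2)%:C *: kfun v L).
  by rewrite st_linear stZ mulN1r addrC.
apply: st_ge0 => x; rewrite CXE_add !CXE_scale.
have -> : kfun (kL f v) L x = (cmod (f x) ^+ 2)%:C * kfun v L x.
  rewrite !kfunE mulr_sumr; apply: eq_bigr => s _.
  rewrite mulr_sumr; apply: eq_bigr => t _.
  have e u : kL f v u x = f x * v u x by [].
  by rewrite !e -mulJc rmorphM /=; ring.
rewrite mulN1r addrC -mulrBl -rmorphB mulr_ge0 ?kfun_ge0 // ler0c subr_ge0.
by rewrite ler_pXn2r ?nnegrE ?cmod_ge0.
Qed.

Lemma kU_linear s c u v : kU s (c *: u + v) = c *: kU s u + kU s v.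
Proof.
by apply: fs_eqP => t; rewrite fsE_lin; exact: tau_linear.
Qed.

Lemma kU1 v : kU 1%g v = v.
Proof. by apply: fs_eqP => t /=; rewrite invg1 mul1g tau1. Qed.

Lemma kUM s t v : kU (s * t)%g v = kU s (kU t v).
Proof. by apply: fs_eqP => x /=; rewrite tau_tau invgM mulgA. Qed.

(** Combines left invariance of the kernel with invariance of the state. *)
Lemma kU_star s u v : kip (kU s u) v = kip u (kU s^-1%g v).
Proof.
rewrite /= /kdot (reindex_fsbig _ _ _ _ (bij_mulg s)).
apply: eq_fsbigr => p _ /=.
rewrite (reindex_fsbig _ _ _ _ (bij_mulg s)).
apply: eq_fsbigr => t _ /=.
rewrite kernel_shift !mulgA mulVg !mul1g invgK; congr (_ * _).
rewrite -(st_tau I s (u p * _)) tauM_mul -tau_star tau_tau.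
by rewrite mulgV tau1.
Qed.

Lemma kUL s f v : kU s (kL f v) = kL (tau al s f) (kU s v).
Proof. by apply: fs_eqP => t /=; rewrite tauM_mul. Qed.

Definition kernel_cov : cov_rep al kip :=
  CovRep kL_linearl kL_linearr kLM kL_star kL_bounded kU_linear kU1 kUM kU_star kUL.

(** For finitely supported v the coefficient is a finite sum of terms with factor
    [kernel r (g * s) t]; the weight [w s t] pays for moving s and t out of the word length. *)
Lemma kernel_cov_decay (v : V) : exists2 C, 0 <= C & forall g,
  cmod (kip (kU g (kL 1 v)) v) <= C * r ^+ wlen g.
Proof.
have [L uL hL] := fs_supp v.
have kL1 : kL 1 v = v by apply: fs_eqP => t /=; rewrite mul1r.
pose n s := snorm st_ip (v s).
pose w (s t : F2) := (r ^+ (wlen t + wlen s))^-1.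
exists (\sum_(s <- L) \sum_(t <- L) w s t * (n s * n t)) => [|g].
  apply: sumr_ge0 => s _; apply: sumr_ge0 => t _.
  by rewrite mulr_ge0 ?invr_ge0 ?exprn_ge0 ?mulr_ge0 ?snorm_ge0 // ltW.
rewrite kL1 /= /kdot (reindex_fsbig _ _ _ _ (bij_mulg g)) /=.
rewrite (fsum_seq uL); last first.
  move=> s sL; apply: fsbig1 => t _.
  rewrite mulgA mulVg mul1g (hL _ sL) tau0.
  by have := ip0l st_ip (v t); rewrite /= => ->; rewrite mulr0.
apply: le_trans (cmod_sum _ _ _) _; rewrite mulr_suml; apply: ler_sum => s _.
rewrite (fsum_seq uL); last first.
  move=> t tL.
  have := ip0r st_ip (tau al g (v (g^-1 * (g * s))%g)).
  by rewrite /= (hL _ tL) => ->; rewrite mulr0.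
apply: le_trans (cmod_sum _ _ _) _; rewrite mulr_suml; apply: ler_sum => t _.
rewrite mulgA mulVg mul1g cmodM cmodr ger0_norm ?kernel_ge0 ?(ltW r_gt0) //.
have h1 : cmod (I (tau al g (v s) * CX_star (v t))) <= n s * n t.
  by rewrite /n -(snorm_tau g (v s)); exact: (ip_CS st_ip).
have h2 : kernel r (g * s)%g t <= w s t * r ^+ wlen g.
  rewrite mulrC ler_pdivlMr ?exprn_gt0 //.
  by apply: kernel_decay => //; exact: ltW.
rewrite mulrAC ler_pM ?cmod_ge0 //.
by apply: kernel_ge0; exact: ltW.
Qed.

(** The cyclic vector of the GNS construction, namely the unit of the algebra. *)
Definition kone : V := @fs_of_seq R F2 CX [:: 1%g] (fun _ => 1 : CX).

Lemma kernel_cov_coef g : kip (kU g (kL 1 kone)) kone = (r ^+ wlen g)%:C.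
Proof.
rewrite /= /kdot (fsum_seq (L := [:: g])) // => [|s]; last first.
  rewrite inE => sg; apply: fsbig1 => t _ /=.
  rewrite inE ifF; last first.
    apply/negbTE; apply: contra sg => /eqP e.
    by rewrite -(mulg1 g) -e mulgA mulgV mul1g.
  by rewrite mulr0 tau0; have := ip0l st_ip (kone t); rewrite /= => ->; rewrite mulr0.
rewrite big_seq1 (fsum_seq (L := [:: 1%g])) // => [|t]; last first.
  move=> t1; have -> : kone t = 0 by rewrite /= (negbTE t1).
  by rewrite (ip0r st_ip) mulr0.
rewrite big_seq1 /= mulVg !inE !eqxx mulr1 tau_one.
have -> : CX_star (1 : CX) = 1 by apply: CX_eqP => x; exact: conjc1.
by rewrite mulr1 st1 mulr1 /kernel invg1 mul1g.
Qed.

End KernelRepresentation.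

(** * The norm of the sum of the generators and their inverses *)

Section Growth.
Variable R : realType.

(** If m > l, Bernoulli's inequality makes (m / l)^k grow at least linearly. Only positive exponents
    are assumed, because a degenerate unit is absorbed only after one application of x. *)
Lemma geometric_growth (a C m l : R) : 0 < a -> 0 <= m -> 0 <= l ->
  (forall k, a * m ^+ k.+1 <= C * l ^+ k.+1) -> m <= l.
Proof.
move=> a0 m0 l0 h; rewrite leNgt; apply/negP => lm.
have mp : 0 < m by exact: le_lt_trans lm.
have [l00|l1] := eqVneq l 0.
  have := h 0; rewrite l00 !expr1 mulr0; have := mulr_gt0 a0 mp; lra.
have lp : 0 < l by rewrite lt0r l1.
pose d := m / l - 1.
have d0 : 0 < d by rewrite subr_gt0 ltr_pdivlMr // mul1r.
have bern k : 1 + k%:R * d <= (m / l) ^+ k.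
  elim: k => [|k IH]; first by rewrite mul0r addr0 expr0.
  rewrite exprS (_ : m / l = 1 + d); last by rewrite /d; ring.
  rewrite (_ : m / l = 1 + d) in IH; last by rewrite /d; ring.
  have k0 : 0 <= k%:R :> R by exact: ler0n.
  apply: le_trans (ler_wpM2l _ IH); last by lra.
  rewrite -natr1; have := mulr_ge0 k0 (sqr_ge0 d); nra.
have C0 : 0 < C.
  have := h 0; rewrite !expr1 => h0.
  by rewrite -(pmulr_lgt0 _ lp); apply: lt_le_trans h0; exact: mulr_gt0.
have ad : 0 < a * d by exact: mulr_gt0.
have := archi_boundP (ltW (divr_gt0 C0 ad)).
set N := Num.bound _ => hN.
have h1 : a * (m / l) ^+ N.+1 <= C.
  by rewrite expr_div_n mulrA ler_pdivrMr ?exprn_gt0 // h.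
have h2 := ler_wpM2l (ltW a0) (bern N.+1).
rewrite ltr_pdivrMr // in hN.
rewrite -natr1 in h2; lra.
Qed.

Variables (V : lmodType R[i]) (B : semi_inner V) (T : V -> V).
Hypothesis T_sym : forall u v, B (T u) v = B u (T v).

(* The norms |T^k v| are log-convex in k, so a bound on their growth rate is a
   bound on their first ratio. *)
Lemma symmetric_power_bound (v : V) (C l : R) : 0 <= l ->
  (forall k, cmod (B (iter k.+1 T v) v) <= C * l ^+ k.+1) ->
  snorm B (T v) <= l * snorm B v.
Proof.
move=> l0 h; pose n k := snorm B (iter k T v).
have sym k u w : B (iter k T u) w = B u (iter k T w).
  by elim: k u w => //= k IH u w; rewrite T_sym IH -iterS iterSr.
have logc k : n k.+1 ^+ 2 <= n k * n k.+2.
  rewrite /n sqr_snorm [in X in B X _]iterS T_sym -iterS.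
  exact: le_trans (ler_norm _) (le_trans (Re_cmod _) (ip_CS _ _ _)).
rewrite leNgt; apply/negP => lt1; have {}lt1 : l * n 0 < n 1 := lt1.
have n1 : 0 < n 1 by apply: le_lt_trans lt1; rewrite mulr_ge0 ?snorm_ge0.
have n0 : 0 < n 0.
  rewrite lt0r snorm_ge0 andbT; apply/eqP => n00.
  have := logc 0; rewrite n00 mul0r; have := exprn_gt0 2 n1; lra.
pose q := n 1 / n 0.
have q0 : 0 < q by exact: divr_gt0.
have ratio k : 0 < n k /\ q * n k <= n k.+1.
  elim: k => [|k [nk IH]]; first by rewrite /q divfK ?gt_eqF.
  have nk1 : 0 < n k.+1 by apply: lt_le_trans IH; exact: mulr_gt0.
  split => //; rewrite -(ler_pM2r nk).
  apply: le_trans (_ : n k.+1 ^+ 2 <= _); last by rewrite mulrC logc.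
  by rewrite expr2 mulrAC ler_pM2r.
have lower k : n 0 * q ^+ k <= n k.
  elim: k => [|k IH]; first by rewrite expr0 mulr1.
  have [_ h1] := ratio k; apply: le_trans h1.
  by rewrite exprS mulrCA ler_pM2l.
(* As |T^k v|^2 = <T^(2k) v, v>, the hypothesis at even exponents bounds (n 0 * q^k)^2 by C l^(2k);
   this contradicts q > l. *)
have ql : q ^+ 2 <= l ^+ 2.
  apply: (@geometric_growth (n 0 ^+ 2) C); rewrite ?exprn_gt0 ?sqr_ge0 // => k.
  have h1 : (n 0 * q ^+ k.+1) ^+ 2 <= n k.+1 ^+ 2.
    rewrite ler_pXn2r ?nnegrE ?snorm_ge0 ?lower //.
    by rewrite mulr_ge0 ?snorm_ge0 ?exprn_ge0 ?(ltW q0).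
  rewrite -exprM mulnC exprM -exprMn; apply: le_trans h1 _.
  have -> : n k.+1 ^+ 2 = complex.Re (B (iter (k.+1 + k.+1) T v) v).
    by rewrite /n sqr_snorm -sym -iterD.
  apply: le_trans (ler_norm _) (le_trans (Re_cmod _) _).
  by have := h (k + k.+1)%N; rewrite -exprM mul2n -addnn.
rewrite ler_pXn2r ?nnegrE ?(ltW q0) // in ql.
move: lt1; rewrite ltNge -ler_pdivrMr // -/q => /negP; apply; exact: ql.
Qed.

End Growth.

(** * Norm bounds from the decay of coefficients *)

Section GeneratorSum.
Variables (R : realType) (X : topologicalType) (al : haction F2 X).
Local Open Scope complex_scope.
Local Notation gens := [seq gen l | l <- letters].

Lemma gensum_in : (fun s : F2 => if s \in gens then 1 else 0 : CX R X) \in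
  @fin_supp R F2 X.
Proof.
rewrite inE /=; apply: (@sub_finite_set _ _ [set` gens]); last exact: finite_seq.
by move=> s /=; case: ifP => //; rewrite eqxx.
Qed.

Definition gensum : Cc R F2 X := MkCc gensum_in.

Variables (V : lmodType R[i]) (B : semi_inner V) (cov : cov_rep al B).
Local Notation L := (covL cov).
Local Notation U := (covU cov).
Local Notation pi := (integ_rep cov).

Lemma uniq_gens : uniq gens.
Proof. by rewrite map_inj_uniq // => l m /(congr1 (@fword bool)) []. Qed.

Lemma prep_gensum v : pi gensum v = \sum_(l <- letters) L 1 (U (gen l) v).
Proof.
rewrite [LHS](integ_seq _ _ uniq_gens); last by move=> s /negbTE /= ->.
rewrite big_map; apply: eq_big_seq => l ll.
have e : gen l \in gens := map_f gen ll.
by have -> : gensum (gen l) = 1 by exact: (ifT _ _ e).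
Qed.

Lemma covU_L1 s v : U s (L 1 v) = L 1 (U s v).
Proof. by rewrite covUL tau_one. Qed.

Lemma covL1_L1 v : L 1 (L 1 v) = L 1 v.
Proof. by rewrite -covLM mulr1. Qed.

Lemma gensum_L1 v : pi gensum (L 1 v) = pi gensum v.
Proof. by rewrite !prep_gensum; apply: eq_bigr => l _; rewrite covU_L1 covL1_L1. Qed.

Lemma gensum_UL1 g v :
  pi gensum (U g (L 1 v)) = \sum_(l <- letters) U (gen l * g)%g (L 1 v).
Proof.
rewrite prep_gensum; apply: eq_bigr => l _.
by rewrite -covUM covU_L1 covL1_L1.
Qed.

Lemma prep_sum a (J : Type) (s : seq J) (F : J -> V) :
  pi a (\sum_(i <- s) F i) = \sum_(i <- s) pi a (F i).
Proof.
elim: s => [|i s IH]; rewrite ?big_nil ?big_cons.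
  by have := prepZr pi a 0 0; rewrite !scale0r.
by have := prep_linearr pi a 1 (F i) (\sum_(j <- s) F j); rewrite !scale1r IH.
Qed.

Lemma iter_prep_sum a k (J : Type) (s : seq J) (F : J -> V) :
  iter k (pi a) (\sum_(i <- s) F i) = \sum_(i <- s) iter k (pi a) (F i).
Proof. by elim: k => [//|k IH]; rewrite iterS IH prep_sum. Qed.

Lemma gensum_sym u v : B (pi gensum u) v = B u (pi gensum v).
Proof.
have adj l w : B (L 1 (U (gen l) u)) w = B u (L 1 (U (gen (linv l)) w)).
  have s1 : CX_star 1 = 1 :> CX R X by apply: CX_eqP => x; exact: conjc1.
  rewrite covL_star covU_star s1 covU_L1; congr (B u (L 1 (U _ w))).
  exact: val_inj.
rewrite !prep_gensum ip_suml ip_sumr.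
under eq_bigr do rewrite adj.
(* The letters are closed under inversion, so taking adjoints only permutes the terms. *)
rewrite !big_cons !big_nil /linv /=; ring.
Qed.

Lemma iter_gensumS k g v :
  B (iter k.+1 (pi gensum) (U g (L 1 v))) v =
  \sum_(l <- letters) B (iter k (pi gensum) (U (gen l * g)%g (L 1 v))) v.
Proof. by rewrite iterSr gensum_UL1 iter_prep_sum ip_suml. Qed.

(** C may depend on v: [symmetric_power_bound] discards it and leaves a bound uniform in v. The
    induction runs over all g at once, since each power of x moves g to its neighbours. *)
Lemma pnorm_gensum_le r : 0 < r -> r <= 1 ->
  (forall v, exists2 C, 0 <= C &
    forall g, cmod (B (U g (L 1 v)) v) <= C * r ^+ wlen g) ->
  pnorm pi gensum <= lam r.
Proof.
move=> r0 r1 decay.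
have l0 : 0 <= lam r by rewrite addr_ge0 ?mulr_ge0 ?invr_ge0 // ltW.
apply: pnorm_le => // v; have [C C0 hC] := decay v.
have bound k g : cmod (B (iter k (pi gensum) (U g (L 1 v))) v) <=
    C * lam r ^+ k * r ^+ wlen g.
  elim: k g => [|k IH] g; first by rewrite expr0 mulr1; exact: hC.
  rewrite iter_gensumS; apply: le_trans (cmod_sum _ _ _) _.
  apply: le_trans (ler_sum _ (fun l _ => IH (gen l * g)%g)) _.
  have -> : C * lam r ^+ k.+1 * r ^+ wlen g = C * lam r ^+ k * (lam r * r ^+ wlen g).
    by rewrite exprSr; ring.
  by rewrite -mulr_sumr ler_wpM2l ?mulr_ge0 ?exprn_ge0 // sum_gen_le.
apply: (@symmetric_power_bound _ _ _ _ gensum_sym v C) => // k.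
have := bound k.+1 1%g.
by rewrite covU1 iterSr gensum_L1 -iterSr /wlen /= expr0 mulr1.
Qed.

Lemma pnorm_gensum_ge r v : 2 / 3 < r -> r < 1 ->
  (forall g, B (U g (L 1 v)) v = (r ^+ wlen g)%:C) ->
  lam r <= pnorm pi gensum.
Proof.
move=> r0 r1 coef.
have l0 : 0 <= lam r by rewrite addr_ge0 ?mulr_ge0 ?invr_ge0 //; lra.
(* A lower bound needs the exact eigenfunction, as r^|g| is only superharmonic at the root. *)
have bound k g : lam r ^+ k * spherical r (wlen g) <=
    complex.Re (B (iter k (pi gensum) (U g (L 1 v))) v).
  elim: k g => [|k IH] g; first by rewrite expr0 mul1r coef /= spherical_le.
  rewrite iter_gensumS (big_morph _ (@ReD R) (erefl _ : complex.Re 0 = 0)).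
  apply: le_trans (ler_sum _ (fun l _ => IH (gen l * g)%g)).
  by rewrite -mulr_sumr sum_spherical // exprSr mulrA.
pose p := pnorm pi gensum; have p0 : 0 <= p := pnorm_ge0 _ _.
have pow k w : snorm B (iter k (pi gensum) w) <= p ^+ k * snorm B w.
  elim: k => [|k IH]; first by rewrite expr0 mul1r.
  rewrite iterS; apply: le_trans (snorm_prep _ _ _) _.
  by rewrite exprS -mulrA ler_wpM2l.
apply: (@geometric_growth _ (spherical r 0)
  (snorm B (U 1%g (L 1 v)) * snorm B v)) => //.
  exact: spherical0.
move=> k; rewrite mulrC; apply: le_trans (bound k.+1 1%g) _.
apply: le_trans (ler_norm _) (le_trans (Re_cmod _) (le_trans (ip_CS _ _ _) _)).
by rewrite mulrAC mulrC [X in _ <= X]mulrC ler_wpM2l ?snorm_ge0 // mulrC.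
Qed.

End GeneratorSum.

(** * Uncountably many norms *)

Section RegularDecay.
Variables (R : realType) (X : topologicalType) (al : haction F2 X).
Variables (X_compact : compact [set: X]) (H : hilbert R) (rho : CX_rep X H).
Local Notation cov := (reg_cov al X_compact rho).

Lemma reg_cov_decay r (v : fs F2 H) : 0 < r -> r <= 1 -> exists2 C, 0 <= C &
  forall g, cmod (reg_ip F2 H (covU cov g (covL cov 1 v)) v) <= C * r ^+ wlen g.
Proof.
move=> r0 r1; have [L uL hL] := fs_supp v.
pose N := (\sum_(t <- L) wlen t)%N.
have hN t : t \in L -> (wlen t <= N)%N.
  by move=> tL; rewrite /N (big_rem t tL) /= leq_addr.
set n := snorm (reg_ip F2 H) (covL cov 1 v) * snorm (reg_ip F2 H) v.
have n0 : 0 <= n by rewrite mulr_ge0 ?snorm_ge0.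
have rN : 0 < r ^+ (N + N) by rewrite exprn_gt0.
(* If |g| <= 2N, the quotient r^|g| / r^(2N) is at least 1 and Cauchy-Schwarz suffices; if |g| > 2N,
   translation by g separates the supports. *)
exists (n / r ^+ (N + N)) => [|g]; first by rewrite divr_ge0 // ltW.
have [gN|gN] := leqP (wlen g) (N + N).
  apply: le_trans (ip_CS _ _ _) _; rewrite snorm_covU -/n.
  rewrite -mulrA ler_peMr // mulrC ler_pdivlMr // mul1r.
  by rewrite ler_wiXn2l // ltW.
have -> : reg_ip F2 H (covU cov g (covL cov 1 v)) v = 0.
  apply: fsbig1 => t _; have [tL|/hL ->] := boolP (t \in L); last exact: linear0r.
  rewrite /= [v (g^-1 * t)%g]hL ?linear0 ?linear0l //.
  apply/negP => sL; move: gN; rewrite ltnNge => /negP; apply.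
  have -> : g = (t * (g^-1 * t)^-1)%g by rewrite invgM invgK mulgA mulgV mul1g.
  by apply: leq_trans (wlenM _ _) _; rewrite wlenV leq_add ?hN.
by rewrite cmod0 mulr_ge0 ?divr_ge0 ?exprn_ge0 // ltW.
Qed.

End RegularDecay.

(** Countable sets are Lebesgue null, and an injection from A into a countable S would make A
    countable. *)
Lemma uncountable_image (R : realType) (T : Type) (A : set R) (f : R -> T) (S : set T) :
  {in A &, injective f} -> (forall r, A r -> S (f r)) ->
  lebesgue_measure A != 0%E -> ~ countable S.
Proof.
move=> fi fS /eqP mA cS; apply: mA; apply: countable_lebesgue_measure0.
rewrite -(eq_countable (inj_card_eq fi)); apply: sub_countable cS.
by apply: subset_card_le => _ [r Ar <-]; exact: fS.
Qed.

Section MaxNorm.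
Variables (R : realType) (A : lmodType R[i]) (mul : A -> A -> A) (star : A -> A).
Variables (V W : lmodType R[i]) (B : semi_inner V) (C : semi_inner W).
Variables (pi : pre_rep mul star B) (sigma : pre_rep mul star C).
Local Open Scope complex_scope.

(** The norm of the direct sum of the two representations. *)
Definition max_norm a : R := Num.max (pnorm pi a) (pnorm sigma a).

Lemma max_cstar_norm : (forall a, pnorm pi a = 0 -> a = 0) ->
  cstar_norm mul star max_norm.
Proof.
move=> faith.
have pl a : pnorm pi a <= max_norm a by rewrite le_max lexx.
have pr a : pnorm sigma a <= max_norm a by rewrite le_max lexx orbT.
have m0 a : 0 <= max_norm a by apply: le_trans (pl a); exact: pnorm_ge0.
split => //.
- move=> a a0; apply: faith; apply/le_anti; rewrite pnorm_ge0 andbT.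
  by rewrite -a0.
- by move=> a b; rewrite ge_max !(le_trans (pnormD _ _ _)) ?lerD.
- move=> c a; rewrite normc_cmod -rmorphM /max_norm !pnormZ.
  by rewrite maxr_pMr ?cmod_ge0.
- move=> a b; rewrite ge_max !(le_trans (pnormM _ _ _)) ?ler_pM ?pnorm_ge0 //.
- move=> a; rewrite /max_norm !pnorm_cstar.
  have sq x y : 0 <= x -> x <= y -> Num.max (x ^+ 2) (y ^+ 2) = Num.max x y ^+ 2 :> R.
    move=> x0 xy; rewrite !max_r // ler_pXn2r ?nnegrE //; exact: le_trans xy.
  have [h|h] := leP (pnorm pi a) (pnorm sigma a).
    by rewrite sq ?pnorm_ge0 // max_r.
  by rewrite maxC sq ?pnorm_ge0 ?(ltW h) // max_r ?(ltW h).
Qed.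

End MaxNorm.

Theorem theorem3p6 (R : realType) (X : ptopologicalType)
    (X_compact : compact [set: X]) (X_hausdorff : hausdorff_space X)
    (al : haction F2 X) (al_free : free_action al)
    (mu : probability (borel X) R)
    (mu_regular : regular_measure mu) (mu_invariant : invariant_measure al mu)
    (H : hilbert R) (rho : CX_rep X H) (rho_faithful : faithful rho) :
  ~ countable [set eta : Cc R F2 X -> R |
      cstar_norm (Cc_mul al) (Cc_star al) eta /\
      forall x, (reduced_norm al rho x <= (eta x)%:E <= full_norm al x)%E].
Proof.
pose I := int_state X_compact mu_invariant.
pose red := integ_rep (reg_cov al X_compact rho).
(* The family is total in r, with the zero function as default outside the interval; the value at
   [gensum] is kept to separate the norms. *)
have /choice[ker kerP] (r : R) : exists eta : Cc R F2 X -> R, 2 / 3 < r -> r < 1 ->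
    [/\ cstar_norm (Cc_mul al) (Cc_star al) eta,
    forall x, (reduced_norm al rho x <= (eta x)%:E <= full_norm al x)%E &
    eta (gensum R X) = lam r].
  have [r0|] := ltrP (2 / 3) r; last by exists (fun=> 0).
  have [r1|] := ltrP r 1; last by exists (fun=> 0).
  have rp : 0 < r by lra.
  pose kr := integ_rep (kernel_cov X_compact I rp r1).
  exists (max_norm red kr) => _ _; split.
  - by apply: max_cstar_norm => a; exact: pnorm_reg_eq0.
  - move=> x; apply/andP; split.
      apply: le_trans (reduced_norm_le al X_compact rho x) _.
      by rewrite lee_fin le_max lexx.
    by rewrite /max_norm EFin_max ge_max !pnorm_le_full.
  - apply/le_anti; rewrite ge_max le_max; apply/andP; split; last first.
      apply/orP; right; apply: (@pnorm_gensum_ge _ _ _ _ _ _ r (kone R X)) => // g.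
      exact: kernel_cov_coef.
    apply/andP; split; apply: pnorm_gensum_le; rewrite ?(ltW r1) // => v.
      by apply: reg_cov_decay => //; exact: ltW.
    exact: kernel_cov_decay.
apply: (@uncountable_image R _ `]2 / 3, 1[%classic ker).
- move=> r s; rewrite !inE /= !in_itv /= => /andP[r0 r1] /andP[s0 s1] e.
  have [_ _ er] := kerP r r0 r1; have [_ _ es] := kerP s s0 s1.
  by apply: lam_inj => //; rewrite -er -es e.
- move=> r; rewrite /= in_itv /= => /andP[r0 r1].
  by have [h1 h2 _] := kerP r r0 r1.
- have h : 2 / 3 < 1 :> R by lra.
  by rewrite lebesgue_measure_itv /= lte_fin h -EFinB eqe subr_eq0 gt_eqF.
Qed.
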